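(* Let $L=(G,l)$ be a linkage with $M(L)\ne\emptyset$, and suppose there are vertices $u\ne v$ of $G$ with \[(G,u,v)=(P_1,u,v)\|(P_2,u,v)\|\cdots\|(P_n,u,v)\|(K,u,v),\qquad n\ge2,\] where each $P_i$ is a path graph joining $u$ and $v$ whose edges all have positive length, and $K$ is either empty (the factor being absent) or such that $(K,u,v)$ is a TTSPG; let $L_K=(K,l|_K)$. Regard each $P_i$ as a path linkage with restricted lengths and terminals $u,v$, and write $[P_i]=[a_i,b_i]$. Let $a=\max_i a_i$ and $b=\min_i b_i$ (so $a\le b$). Let $Q$ be a path linkage with terminal vertices $s,t$ and four edges $e_1,\dots,e_4$ of lengths $\frac{a+b}{2},\frac{b-a}{6},\frac{b-a}{6},\frac{b-a}{6}$, and let $L_1$ be the linkage defined by $(L_1,u,v)=(Q,s,t)\|(L_K,u,v)$ (i.e. $L$ with all the $P_i$ replaced by the single path $Q$; if $K$ is empty, $L_1=Q$ with $u=s,v=t$). Suppose $\nabla(P_i)\cap[L,u,v]\ne\emptyset$ for every $i=1,\dots,n$. Then $M(L)$ is connected if and only if $M(L_1)$ is connected.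
   Context: A graph has a finite vertex set and a finite multiset of edges that are unordered pairs of distinct vertices. A linkage is $L=(G,l)$ with $l:E\to\mathbb R_{\ge0}$; $C(L)=\{p:V\to\mathbb R^2:|p(u)-p(v)|=l(\{u,v\})\ \forall\{u,v\}\in E\}$, and $M(L)$ is the quotient of $C(L)$ by the group of orientation preserving isometries of $\mathbb R^2$ (quotient topology). $[L,u,v]=\{|p(u)-p(v)|:p\in M(L)\}$. Parallel composition of TTGs (and linkages, with lengths carried along): $(G_1,s_1,t_1)\|(G_2,s_2,t_2)=(G_1\cup_{s_1\sim s_2,t_1\sim t_2}G_2,s_1,t_1)$; series composition $(G_1,s_1,t_1)\circ(G_2,s_2,t_2)=(G_1\cup_{t_2\sim s_1}G_2,s_2,t_1)$; TTSPGs form the smallest class of TTGs containing a single edge and closed under both compositions. For a path linkage $P$ with endpoints $s,t$, $\theta:M(P)\to\mathbb R$, $\theta(p)=|p(s)-p(t)|$, $[P]=\theta(M(P))$ (a closed interval), and $\nabla(P)=\{x\in[P]:\theta^{-1}(x)\text{ is connected}\}$. *)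

(* Defs.v *)
From Stdlib Require Import Reals Lra List Permutation Arith.
Import ListNotations.
Open Scope R_scope.

(* An edge of a linkage: (endpoint, endpoint, length).  Edges are unordered
   pairs; the orientation of the stored pair is irrelevant for the
   configuration constraints (distance is symmetric). A graph is given by a
   list of edges (a multiset); its vertex set is the set of endpoints. *)
Definition edge (V : Type) := (V * V * R)%type.

Definition vertsOf {V : Type} (E : list (edge V)) : list V :=
  flat_map (fun e => [fst (fst e); snd (fst e)]) E.

Definition vtx {V : Type} (E : list (edge V)) := {w : V | In w (vertsOf E)}.

Definition config {V : Type} (E : list (edge V)) := vtx E -> (R * R)%type.

Definition pdist (p q : R * R) : R :=
  sqrt ((fst p - fst q) ^ 2 + (snd p - snd q) ^ 2).

Definition inC {V : Type} (E : list (edge V)) (p : config E) : Prop :=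
  forall (x y : vtx E) (l : R),
    In (proj1_sig x, proj1_sig y, l) E -> pdist (p x) (p y) = l.

Definition rigid (c s tx ty : R) (z : R * R) : R * R :=
  (c * fst z - s * snd z + tx, s * fst z + c * snd z + ty).

Definition congruent {V : Type} (E : list (edge V)) (p q : config E) : Prop :=
  exists c s tx ty, c ^ 2 + s ^ 2 = 1 /\
    forall w, q w = rigid c s tx ty (p w).

(* Open subsets of M(L) (quotient topology), represented by their preimages
   in C(L): saturated sets that are relatively open in C(L) ⊆ (R^2)^V
   (product topology; V finite). *)
Definition qopen {V : Type} (E : list (edge V)) (U : config E -> Prop) : Prop :=
  (forall p q, inC E p -> inC E q -> congruent E p q -> U p -> U q) /\
  (forall p, inC E p -> U p ->
     exists eps, eps > 0 /\
       forall q, inC E q -> (forall w, pdist (p w) (q w) < eps) -> U q).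

(* Connectedness (subspace topology of M(L)) of the image in M(L) of a
   saturated subset S of C(L). *)
Definition qconnected {V : Type} (E : list (edge V)) (S : config E -> Prop) : Prop :=
  ~ exists U1 U2, qopen E U1 /\ qopen E U2 /\
      (forall p, S p -> U1 p \/ U2 p) /\
      (forall p, S p -> U1 p -> U2 p -> False) /\
      (exists p, S p /\ U1 p) /\ (exists p, S p /\ U2 p).

Definition M_connected {V : Type} (E : list (edge V)) : Prop := qconnected E (inC E).

Definition M_nonempty {V : Type} (E : list (edge V)) : Prop := exists p, inC E p.

Definition dist_at {V : Type} (E : list (edge V)) (p : config E) (u v : V) (x : R) : Prop :=
  exists u' v' : vtx E, proj1_sig u' = u /\ proj1_sig v' = v /\ pdist (p u') (p v') = x.

Definition distRange {V : Type} (E : list (edge V)) (u v : V) (x : R) : Prop :=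
  exists p, inC E p /\ dist_at E p u v x.

(* theta^{-1}(x), as a saturated subset of C *)
Definition fiber {V : Type} (E : list (edge V)) (u v : V) (x : R) (p : config E) : Prop :=
  inC E p /\ dist_at E p u v x.

Definition nabla {V : Type} (E : list (edge V)) (u v : V) (x : R) : Prop :=
  distRange E u v x /\ qconnected E (fiber E u v x).

Fixpoint path_pairs {V : Type} (x : V) (l : list V) : list (V * V) :=
  match l with
  | [] => []
  | y :: l' => (x, y) :: path_pairs y l'
  end.

Definition is_path_graph {V : Type} (E : list (edge V)) (s t : V) : Prop :=
  exists ws : list V, NoDup (s :: t :: ws) /\
    map (fun e => fst e) E = path_pairs s (ws ++ [t]).

Inductive ttsp {V : Type} : list (edge V) -> V -> V -> Prop :=
| tt_edge : forall s t l, s <> t -> ttsp [(s, t, l)] s t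
| tt_edge_rev : forall s t l, s <> t -> ttsp [(t, s, l)] s t
| tt_par : forall E1 E2 s t, ttsp E1 s t -> ttsp E2 s t ->
    (forall w, In w (vertsOf E1) -> In w (vertsOf E2) -> w = s \/ w = t) ->
    ttsp (E1 ++ E2) s t
| tt_ser : forall E1 E2 s1 t1 s2, ttsp E1 s1 t1 -> ttsp E2 s2 s1 ->
    (forall w, In w (vertsOf E1) -> In w (vertsOf E2) -> w = s1) ->
    ttsp (E1 ++ E2) s2 t1
| tt_perm : forall E E' s t, ttsp E s t -> Permutation E E' -> ttsp E' s t.

Definition Ledges {V : Type} (n : nat) (P : nat -> list (edge V)) (EK : list (edge V))
  : list (edge V) := concat (map P (seq 0 n)) ++ EK.

Definition amax (n : nat) (a : nat -> R) : R :=
  fold_right (fun i acc => Rmax (a i) acc) (a 0%nat) (seq 0 n).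
Definition bmin (n : nat) (b : nat -> R) : R :=
  fold_right (fun i acc => Rmin (b i) acc) (b 0%nat) (seq 0 n).

(* L_1 = Q || L_K on vertex type option (option (option V)):
   three fresh internal vertices of Q, old vertices via lift. *)
Definition lift {V : Type} (x : V) : option (option (option V)) := Some (Some (Some x)).
Definition liftE {V : Type} (e : edge V) : edge (option (option (option V))) :=
  (lift (fst (fst e)), lift (snd (fst e)), snd e).
Definition L1_edges {V : Type} (u v : V) (a b : R) (EK : list (edge V))
  : list (edge (option (option (option V)))) :=
  [ (lift u, None, (a + b) / 2);
    (None, Some None, (b - a) / 6);
    (Some None, Some (Some None), (b - a) / 6);
    (Some (Some None), lift v, (b - a) / 6) ] ++ map liftE EK.

(* Main.v *)
Require Import Defs.
From Stdlib Require Import Reals Lra Lia List Arith.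
From Stdlib Require Import Classical ClassicalDescription ProofIrrelevance.
Import ListNotations.
Open Scope R_scope.

(* Let [x] be the distance between the ends of a polygonal chain.  The chains
   with given [x] either form a connected set or split into two mirror
   families; whether they split, and into which family a chain falls, is read
   off by removing the first edge.  The two families, each completed with all
   the chains at the distances where no splitting occurs, are closed and have
   connected nonempty fibres over every attainable [x].

   Hence, if a path is added to a linkage all of whose configurations keep its
   terminals at attainable distances, the new configuration space is the union
   of two closed pieces, each proper with connected fibres over the old space;
   and the pieces meet as soon as some configuration realizes a distance without
   splitting.  So adding the path changes nothing to connectedness.  Applied
   successively to the [P_i], and to [Q], which never splits, this shows that
   [M(L)] and [M(L_1)] are both connected exactly when the space of the
   configurations of [K] with [a <= |p(u) - p(v)| <= b] is. *)

(** * Plane geometry and clusters *)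

(** The obstacle is that forgetting a path is a proper map whose fibres may be disconnected: with
    the ends held fixed, a chain and its mirror image can lie in different components. A surjective
    proper map with connected fibres transfers connectedness in both directions, and keeping one
    family at the splitting distances restores this situation. Closedness of the families is the
    delicate point. It holds because splitting is a relatively open condition on the distance of the
    ends, so the extra constraint is imposed only on an open set of distances. A straight chain
    never splits. Hence the two causes of splitting (a first edge that never aligns with the ends,
    or a remainder that splits at every admissible distance) exclude each other, and at most one
    constraint is active at a time. The hypothesis on [nabla] enters by contraposition: at a
    splitting distance the two families disconnect the fibre. Deleting a path needs less than adding
    one, only that every configuration extends to the path. Compactness comes from the completeness
    of the reals, through properties [Z e] that weaken as [e] grows, in place of sequences. *)

Notation R2 := (R * R)%type.

Definition cross (A B p : R2) : R :=
  (fst p - fst A) * (snd B - snd A) - (snd p - snd A) * (fst B - fst A).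

Lemma pdist_ge0 p q : 0 <= pdist p q.
Proof. apply sqrt_pos. Qed.

Lemma pdist_sqr p q :
  pdist p q ^ 2 = (fst p - fst q) ^ 2 + (snd p - snd q) ^ 2.
Proof.
  unfold pdist; apply pow2_sqrt, Rplus_le_le_0_compat; apply pow2_ge_0.
Qed.

Lemma pdist_eq_sqr p q d : 0 <= d ->
  (fst p - fst q) ^ 2 + (snd p - snd q) ^ 2 = d ^ 2 -> pdist p q = d.
Proof. intros hd h; unfold pdist; rewrite h; now apply sqrt_pow2. Qed.

Lemma pdist_refl p : pdist p p = 0.
Proof. apply pdist_eq_sqr; [lra | ring]. Qed.

Lemma pdist_sym p q : pdist p q = pdist q p.
Proof.
  apply pdist_eq_sqr; [apply pdist_ge0 | rewrite pdist_sqr; ring].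
Qed.

Lemma pdist_eq0 p q : pdist p q = 0 -> p = q.
Proof.
  intros h; pose proof (pdist_sqr p q) as e; rewrite h in e.
  rewrite pow_i, <- !Rsqr_pow2 in e by auto with arith.
  destruct (Rplus_sqr_eq_0 _ _ (eq_sym e)).
  destruct p, q; simpl in *; f_equal; lra.
Qed.

Lemma pdist_triangle p q r : pdist p r <= pdist p q + pdist q r.
Proof.
  pose proof (triangle (fst p) (snd p) (fst r) (snd r) (fst q) (snd q)) as h.
  unfold dist_euc in h; rewrite !Rsqr_pow2 in h; exact h.
Qed.

Lemma pdist_lipschitz p q p' q' :
  Rabs (pdist p q - pdist p' q') <= pdist p p' + pdist q q'.
Proof.
  pose proof (pdist_triangle p p' q); pose proof (pdist_triangle p' q' q).
  pose proof (pdist_triangle p' p q'); pose proof (pdist_triangle p q q').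
  rewrite (pdist_sym p' p) in *; rewrite (pdist_sym q' q) in *.
  apply Rabs_le; lra.
Qed.

Lemma pdist_coord p q :
  Rabs (fst p - fst q) <= pdist p q /\ Rabs (snd p - snd q) <= pdist p q.
Proof.
  pose proof (pdist_sqr p q).
  pose proof (pow2_ge_0 (fst p - fst q)); pose proof (pow2_ge_0 (snd p - snd q)).
  rewrite <- (Rabs_pos_eq (pdist p q)) by apply pdist_ge0.
  split; apply Rsqr_le_abs_0; rewrite !Rsqr_pow2; lra.
Qed.

Lemma pdist_le_coord p q :
  pdist p q <= Rabs (fst p - fst q) + Rabs (snd p - snd q).
Proof.
  pose proof (Rabs_pos (fst p - fst q)); pose proof (Rabs_pos (snd p - snd q)).
  pose proof (pdist_sqr p q) as e; pose proof (pdist_ge0 p q).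
  rewrite <- (pow2_abs (fst p - fst q)), <- (pow2_abs (snd p - snd q)) in e.
  nra.
Qed.

Lemma pdist_rigid c s tx ty p q : c ^ 2 + s ^ 2 = 1 ->
  pdist (rigid c s tx ty p) (rigid c s tx ty q) = pdist p q.
Proof.
  intros h; apply pdist_eq_sqr; [apply pdist_ge0 |].
  rewrite pdist_sqr; simpl.
  transitivity ((c ^ 2 + s ^ 2) * ((fst p - fst q) ^ 2 + (snd p - snd q) ^ 2));
    [ring | rewrite h; ring].
Qed.

Lemma cross_rigid c s tx ty A B p : c ^ 2 + s ^ 2 = 1 ->
  cross (rigid c s tx ty A) (rigid c s tx ty B) (rigid c s tx ty p)
  = cross A B p.
Proof.
  intros h; unfold cross; simpl.
  transitivity ((c ^ 2 + s ^ 2) * cross A B p);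
    [unfold cross; ring | rewrite h; unfold cross; ring].
Qed.

Lemma cross_continuous A B p eps : 0 < eps -> exists d, 0 < d /\
  forall A' B' p', pdist A A' < d -> pdist B B' < d -> pdist p p' < d ->
    Rabs (cross A B p - cross A' B' p') < eps.
Proof.
  intros he.
  set (m := Rabs (fst p - fst A) + Rabs (snd p - snd A)
            + Rabs (snd B - snd A) + Rabs (fst B - fst A) + 4).
  pose proof (Rabs_pos (fst p - fst A)); pose proof (Rabs_pos (snd p - snd A)).
  pose proof (Rabs_pos (snd B - snd A)); pose proof (Rabs_pos (fst B - fst A)).
  assert (hm : 4 <= m) by (unfold m; lra).
  exists (Rmin 1 (eps / (4 * m))).
  assert (hq : 0 < eps / (4 * m)) by (apply Rdiv_lt_0_compat; lra).
  split; [apply Rmin_glb_lt; lra |].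
  intros A' B' p' hA hB hp.
  set (d := Rmin 1 (eps / (4 * m))) in *.
  assert (d1 : d <= 1) by apply Rmin_l.
  assert (d2 : d <= eps / (4 * m)) by apply Rmin_r.
  assert (d3 : 4 * m * d <= eps).
  { replace eps with (4 * m * (eps / (4 * m))) by (field; lra).
    apply Rmult_le_compat_l; lra. }
  destruct (pdist_coord A A'), (pdist_coord B B'), (pdist_coord p p').
  assert (key : forall a b a' b', Rabs (a - a') < 2 * d -> Rabs (b - b') < 2 * d ->
     Rabs (a * b - a' * b') < 2 * d * (Rabs a + Rabs b + 2)).
  { intros a b a' b' ha hb.
    replace (a * b - a' * b') with (a * (b - b') + (a - a') * b - (a - a') * (b - b')) by ring.
    pose proof (Rabs_pos a); pose proof (Rabs_pos b).
    pose proof (Rabs_pos (a - a')); pose proof (Rabs_pos (b - b')).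
    eapply Rle_lt_trans; [apply Rabs_triang |].
    rewrite Rabs_Ropp, Rabs_mult.
    eapply Rle_lt_trans; [apply Rplus_le_compat_r, Rabs_triang |].
    rewrite !Rabs_mult. nra. }
  assert (sub : forall x y x' y', Rabs (x - x') < d -> Rabs (y - y') < d ->
     Rabs ((x - y) - (x' - y')) < 2 * d).
  { intros x y x' y' hx hy; apply Rabs_def2 in hx; apply Rabs_def2 in hy.
    apply Rabs_def1; lra. }
  unfold cross.
  set (k1 := key (fst p - fst A) (snd B - snd A) (fst p' - fst A') (snd B' - snd A')
    ltac:(apply sub; lra) ltac:(apply sub; lra)).
  set (k2 := key (snd p - snd A) (fst B - fst A) (snd p' - snd A') (fst B' - fst A')
    ltac:(apply sub; lra) ltac:(apply sub; lra)).
  clearbody k1 k2. apply Rabs_def2 in k1; apply Rabs_def2 in k2.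
  apply Rabs_def1; unfold m in d3; nra.
Qed.

(** [Z e] holds the candidates at precision [e], so monotonicity in [e] plays the part of a
    sequence. The cluster value is the lower limit: the supremum of the [t] below which some
    precision leaves no candidate. *)
Lemma cluster_real (Z : R -> R -> Prop) (m : R) :
  (forall e e' z, e <= e' -> Z e z -> Z e' z) ->
  (forall e, 0 < e -> exists z, Rabs z <= m /\ Z e z) ->
  exists y, forall e, 0 < e -> exists z, Rabs (z - y) < e /\ Z e z.
Proof.
  intros mono ex.
  set (S := fun t => exists e, 0 < e /\ forall z, Rabs z <= m -> z <= t -> ~ Z e z).
  destruct (completeness S) as [y [ub lub]].
  - exists m; intros t [e [he h]].
    destruct (Rle_lt_dec t m) as [|hlt]; [easy | exfalso].
    destruct (ex e he) as [z [hz hZ]]; apply (h z hz); [| easy].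
    pose proof (Rle_abs z); lra.
  - exists (- m - 1); exists 1; split; [lra |].
    intros z hz hle; pose proof (Rle_abs (- z)); rewrite Rabs_Ropp in *; lra.
  - exists y; intros e he.
    assert (ht : exists t, S t /\ y - e < t).
    { apply NNPP; intros hn.
      assert (y <= y - e); [| lra].
      apply lub; intros t st; apply Rnot_lt_le; intros hlt; apply hn; now exists t. }
    destruct ht as [t [[e0 [he0 h0]] hty]].
    assert (hns : ~ S (y + e / 2)) by (intros hs; apply ub in hs; lra).
    apply NNPP; intros hn; apply hns.
    exists (Rmin e e0); split; [now apply Rmin_glb_lt |].
    intros z hz hle hZ.
    destruct (Rle_lt_dec z t) as [hzt | hzt].
    + apply (h0 z hz hzt); revert hZ; apply mono, Rmin_r.
    + apply hn; exists z; split; [apply Rabs_def1; lra |].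
      revert hZ; apply mono, Rmin_l.
Qed.

Lemma cluster_point (Z : R -> R2 -> Prop) (c : R2) (m : R) :
  (forall e e' z, e <= e' -> Z e z -> Z e' z) ->
  (forall e, 0 < e -> exists z, pdist c z <= m /\ Z e z) ->
  exists y, forall e, 0 < e -> exists z, pdist y z < e /\ Z e z.
Proof.
  intros mono ex.
  set (k := m + Rabs (fst c) + Rabs (snd c)).
  assert (bd : forall z, pdist c z <= m -> Rabs (fst z) <= k /\ Rabs (snd z) <= k).
  { intros z hz; destruct (pdist_coord c z) as [h1 h2]; unfold k.
    pose proof (Rabs_pos (fst c)); pose proof (Rabs_pos (snd c)).
    split.
    - replace (fst z) with (fst c + - (fst c - fst z)) by ring.
      eapply Rle_trans; [apply Rabs_triang |]; rewrite Rabs_Ropp; lra.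
    - replace (snd z) with (snd c + - (snd c - snd z)) by ring.
      eapply Rle_trans; [apply Rabs_triang |]; rewrite Rabs_Ropp; lra. }
  destruct (cluster_real (fun e a => exists z, fst z = a /\ pdist c z <= m /\ Z e z) k)
    as [y1 hy1].
  { intros e e' a he [z [h1 [h2 h3]]]; exists z; eauto. }
  { intros e he; destruct (ex e he) as [z [hz hZ]].
    exists (fst z); split; [now apply bd |]; exists z; auto. }
  (* The second coordinate is clustered among candidates whose first coordinate is already close to
     [y1], so both limits are reached by the same points. *)
  destruct (cluster_real (fun e b => exists z, snd z = b /\ Rabs (fst z - y1) < e
                            /\ pdist c z <= m /\ Z e z) k) as [y2 hy2].
  { intros e e' a he [z [h1 [h2 [h3 h4]]]]; exists z; repeat split; eauto; lra. }
  { intros e he; destruct (hy1 e he) as [a [ha [z [hz1 [hz2 hz3]]]]]; subst a.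
    exists (snd z); split; [now apply bd |]; exists z; auto. }
  exists (y1, y2); intros e he.
  destruct (hy2 (e / 2) ltac:(lra)) as [b [hb [z [h1 [h2 [h3 h4]]]]]]; subst b.
  exists z; split; [| eapply mono; [| eassumption]; lra].
  rewrite pdist_sym; eapply Rle_lt_trans; [apply pdist_le_coord |]; simpl; lra.
Qed.

Lemma interval_connected (H U : R -> Prop) :
  (forall x y z, H x -> H y -> x <= z <= y -> H z) ->
  (forall x, H x -> exists d, 0 < d /\
     forall y, H y -> Rabs (x - y) < d -> (U x <-> U y)) ->
  forall x y, H x -> H y -> U x -> U y.
Proof.
  intros conv.
  assert (main : forall W : R -> Prop, (forall x, H x -> exists d, 0 < d /\
     forall y, H y -> Rabs (x - y) < d -> (W x <-> W y)) ->
     forall x y, x <= y -> H x -> H y -> W x -> W y).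
  { intros W loc x y hxy hx hy wx.
    set (S := fun t => x <= t <= y /\ forall s, x <= s <= t -> W s).
    destruct (completeness S) as [c [ub lub]].
    { exists y; intros t [ht _]; lra. }
    { exists x; split; [lra |]; intros s hs; replace s with x by lra; easy. }
    assert (hxc : x <= c).
    { apply ub; split; [lra |]; intros s hs; replace s with x by lra; easy. }
    assert (hcy : c <= y) by (apply lub; intros t [ht _]; lra).
    destruct (loc c) as [d [hd hl]]; [now apply (conv x y) |].
    assert (ht : exists t, S t /\ c - d < t).
    { apply NNPP; intros hn; assert (c <= c - d); [| lra].
      apply lub; intros t st; apply Rnot_lt_le; intros hlt; apply hn; now exists t. }
    destruct ht as [t [[ht1 ht2] htc]].
    assert (htc' : t <= c) by (apply ub; now split).
    assert (wc : W c).
    { apply (hl t); [apply (conv x y); auto | apply Rabs_def1; lra |].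
      apply ht2; lra. }
    assert (all : forall s, x <= s <= y -> s < c + d -> W s).
    { intros s hs hsd; destruct (Rle_lt_dec s t) as [hst | hst]; [apply ht2; lra |].
      apply (hl s); [apply (conv x y); auto | apply Rabs_def1; lra | easy]. }
    destruct (Rlt_le_dec y (c + d)) as [hlt | hle]; [apply all; lra |].
    assert (c + d / 2 <= c); [| lra].
    apply ub; split; [lra |]; intros s hs; apply all; lra. }
  intros loc x y hx hy ux; destruct (Rle_lt_dec x y) as [hle | hlt].
  - now apply (main U loc x y).
  (* To move leftwards, [main] is applied to the complement of [U], which is locally constant as
     well. *)
  - apply NNPP; intros hn.
    apply (main (fun z => ~ U z)) with (x := y) (y := x); auto; [| lra].
    intros z hz; destruct (loc z hz) as [d [hd hl]]; exists d; split; [easy |].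
    intros w hw hzw; specialize (hl w hw hzw); tauto.
Qed.

(** * Polygonal chains *)

(* [ps] lists the vertices of the chain after [A], so that the last one is [B]. *)
Fixpoint chain (ls : list R) (A B : R2) (ps : list R2) : Prop :=
  match ls, ps with
  | [], [] => A = B
  | l :: ls', p :: ps' => pdist A p = l /\ chain ls' p B ps'
  | _, _ => False
  end.

Fixpoint chain_max (ls : list R) : R :=
  match ls with [] => 0 | l :: ls' => l + chain_max ls' end.

(** A distance [x] is possible when some [r] in the range of [ls'] forms a triangle, perhaps flat,
    with [x] and [l]. The least such [x] is the distance from [l] to the interval from
    [chain_min ls'] to [chain_max ls']. *)
Fixpoint chain_min (ls : list R) : R :=
  match ls with
  | [] => 0
  | l :: ls' => Rmax 0 (Rmax (l - chain_max ls') (chain_min ls' - l))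
  end.

(* When the ends of a chain [l :: ls] are at distance [x], those of [ls] are at
   a distance in [[|x - l|, x + l]].  The first edge never aligns with the ends
   exactly when neither bound is attained by [ls]. *)
Definition turns (l : R) (ls : list R) (x : R) : Prop :=
  Rabs (x - l) < chain_min ls /\ chain_max ls < x + l.

(* The chains with ends at distance [x] fall into two mirror families, told
   apart by the side of the first edge ([turns]) or, inductively, by the rest
   of the chain. *)
Fixpoint splits (ls : list R) (x : R) : Prop :=
  match ls with
  | [] => False
  | l :: ls' => turns l ls' x \/
      forall r, chain_min ls' <= r <= chain_max ls' ->
        Rabs (x - l) <= r <= x + l -> splits ls' r
  end.

(** The second clause of [splits (l :: ls) x], under a name of its own. *)
Definition inherits (l : R) (ls : list R) (x : R) : Prop :=
  forall r, chain_min ls <= r <= chain_max ls ->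
    Rabs (x - l) <= r <= x + l -> splits ls r.

Definition sg (s : bool) : R := if s then 1 else -1.

(* All chains where [splits] fails, one of the two mirror families where it holds. *)
Fixpoint half_chain (s : bool) (ls : list R) (A B : R2) (ps : list R2) : Prop :=
  match ls, ps with
  | [], [] => A = B
  | l :: ls', p :: ps' => pdist A p = l /\ chain ls' p B ps' /\
      (turns l ls' (pdist A B) -> 0 <= sg s * cross A B p) /\
      (inherits l ls' (pdist A B) -> half_chain s ls' p B ps')
  | _, _ => False
  end.

Notation all_nonneg ls := (Forall (fun l => 0 <= l) ls).

Ltac case_abs := unfold Rabs in *; repeat destruct (Rcase_abs _).
Ltac case_max := unfold Rmax in *; repeat destruct (Rle_dec _ _).

Lemma chain_min_le_max ls : all_nonneg ls -> 0 <= chain_min ls <= chain_max ls.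
Proof.
  induction 1 as [| l ls hl _ IH]; simpl; [lra |]; case_max; lra.
Qed.

Lemma chain_range ls A B ps : all_nonneg ls -> chain ls A B ps ->
  chain_min ls <= pdist A B <= chain_max ls.
Proof.
  intros hn; revert A ps; induction hn as [| l ls hl hn IH]; intros A [| p ps]; simpl;
    try easy.
  - intros ->; rewrite pdist_refl; lra.
  - intros [h1 h2]; apply IH in h2.
    pose proof (pdist_triangle A p B); pose proof (pdist_triangle p A B).
    pose proof (pdist_triangle A B p).
    rewrite (pdist_sym p A), (pdist_sym B p) in *.
    pose proof (pdist_ge0 A B); case_max; lra.
Qed.

Lemma half_chain_chain s ls A B ps : half_chain s ls A B ps -> chain ls A B ps.
Proof. destruct ls, ps; simpl; tauto. Qed.

Lemma chain_last ls A B ps : ls <> [] -> chain ls A B ps ->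
  exists qs, ps = qs ++ [B] /\ length ps = length ls.
Proof.
  revert A ps; induction ls as [| l ls IH]; intros A [| p ps] hne; simpl; try easy.
  intros [_ h]; destruct ls as [| l' ls].
  - destruct ps; simpl in h; [subst; now exists [] | easy].
  - destruct (IH p ps) as [qs [e1 e2]]; [easy | easy |].
    exists (p :: qs); split; [now rewrite e1 | simpl in *; congruence].
Qed.

(* At maximal distance the chain is straight. *)
Lemma splits_max ls : all_nonneg ls -> ~ splits ls (chain_max ls).
Proof.
  induction 1 as [| l ls hl hn IH]; simpl; [easy |].
  pose proof (chain_min_le_max ls hn).
  intros [[h _] | h]; [case_abs; lra |].
  apply IH, h; [| case_abs]; lra.
Qed.

(** Under [turns] the remainder may have any distance in its range, including the maximal one, where
    it does not split. The two conditions in [half_chain] are therefore never active together. *)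
Lemma turns_inherits l ls x : all_nonneg ls -> turns l ls x -> ~ inherits l ls x.
Proof.
  intros hn [h1 h2] h; apply (splits_max ls hn), h;
    pose proof (chain_min_le_max ls hn); lra.
Qed.

Lemma chain_cover ls A B ps : all_nonneg ls -> chain ls A B ps ->
  half_chain true ls A B ps \/ half_chain false ls A B ps.
Proof.
  intros hn; revert A ps; induction hn as [| l ls hl hn IH]; intros A [| p ps]; simpl;
    try tauto.
  intros [h1 h2].
  destruct (classic (turns l ls (pdist A B))) as [ht | ht].
  - pose proof (turns_inherits _ _ _ hn ht).
    destruct (Rle_lt_dec 0 (cross A B p)); [left | right];
      (split; [| split; [| split]]); try tauto; intros; lra.
  - destruct (IH p ps h2); [left | right]; tauto.
Qed.

Lemma half_chain_both s ls A B ps : ~ splits ls (pdist A B) ->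
  chain ls A B ps -> half_chain s ls A B ps.
Proof.
  destruct ls, ps; simpl; try tauto; unfold inherits; tauto.
Qed.

(** With a vanishing cross product, Lagrange's identity makes the scalar product equal to plus or
    minus the product of the lengths; the law of cosines then gives the two values. *)
Lemma distance_on_line A B p : cross A B p = 0 ->
  pdist p B = Rabs (pdist A B - pdist A p) \/ pdist p B = pdist A B + pdist A p.
Proof.
  unfold cross; intros hc.
  pose proof (pdist_sqr A B) as e1; pose proof (pdist_sqr A p) as e2.
  pose proof (pdist_sqr p B) as e3.
  pose proof (pdist_ge0 A B) as p1; pose proof (pdist_ge0 A p) as p2.
  pose proof (pdist_ge0 p B) as p3.
  set (x := pdist A B) in *; set (l := pdist A p) in *; set (r := pdist p B) in *.
  set (dot := (fst p - fst A) * (fst B - fst A) + (snd p - snd A) * (snd B - snd A)).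
  assert (e4 : dot ^ 2 = (x * l) ^ 2).
  { transitivity (x ^ 2 * l ^ 2); [| ring]; rewrite e1, e2; unfold dot.
    transitivity (((fst A - fst B) ^ 2 + (snd A - snd B) ^ 2) *
      ((fst A - fst p) ^ 2 + (snd A - snd p) ^ 2) -
      ((fst p - fst A) * (snd B - snd A) - (snd p - snd A) * (fst B - fst A)) ^ 2);
      [ring | rewrite hc; ring]. }
  assert (e5 : r ^ 2 = x ^ 2 + l ^ 2 - 2 * dot)
    by (rewrite e1, e2, e3; unfold dot; ring).
  assert (e6 : (dot - x * l) * (dot + x * l) = 0) by lra.
  apply Rmult_integral in e6; destruct e6 as [e6 | e6].
  - left; rewrite <- (Rabs_pos_eq r p3); apply Rsqr_eq_abs_0.
    rewrite !Rsqr_pow2, e5; replace dot with (x * l) by lra; ring.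
  - right; rewrite <- (Rabs_pos_eq r p3), <- (Rabs_pos_eq (x + l)) by lra.
    apply Rsqr_eq_abs_0.
    rewrite !Rsqr_pow2, e5; replace dot with (- (x * l)) by lra; ring.
Qed.

(** Under [turns], membership in both families puts the first vertex on the line [AB]; its distance
    to [B] is then one of the two values that [turns] places outside the range of the remainder.
    Otherwise the remainder splits at its own distance and induction applies. *)
Lemma half_chain_sep ls A B ps : all_nonneg ls -> splits ls (pdist A B) ->
  half_chain true ls A B ps -> half_chain false ls A B ps -> False.
Proof.
  intros hn; revert A ps; induction hn as [| l ls hl hn IH]; intros A [| p ps];
    simpl; try easy.
  intros hs [h1 [h2 [h3 h4]]] [_ [_ [h3' h4']]].
  pose proof (chain_range _ _ _ _ hn h2) as hr.
  destruct hs as [hs | hs].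
  - specialize (h3 hs); specialize (h3' hs); destruct hs as [t1 t2].
    destruct (distance_on_line A B p); simpl in *; subst l; lra.
  - apply (IH p ps); auto; apply hs; [easy |].
    pose proof (pdist_triangle A p B); pose proof (pdist_triangle p A B).
    pose proof (pdist_triangle A B p).
    rewrite (pdist_sym p A), (pdist_sym B p) in *.
    case_abs; lra.
Qed.

Lemma turns_open l ls x : turns l ls x ->
  exists d, 0 < d /\ forall y, Rabs (x - y) < d -> turns l ls y.
Proof.
  intros [h1 h2]; exists (Rmin (chain_min ls - Rabs (x - l)) (x + l - chain_max ls)).
  split; [apply Rmin_glb_lt; lra |].
  intros y hy; pose proof (Rlt_le_trans _ _ _ hy (Rmin_l _ _)).
  pose proof (Rlt_le_trans _ _ _ hy (Rmin_r _ _)).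
  split; case_abs; lra.
Qed.

Definition rel_open (lo hi : R) (S : R -> Prop) : Prop :=
  forall x, lo <= x <= hi -> S x -> exists d, 0 < d /\
    forall y, lo <= y <= hi -> Rabs (x - y) < d -> S y.

(** The admissible [r] form a compact interval depending continuously on [x]. If the property failed
    arbitrarily near [x], the non-splitting values [r] would cluster at a value admissible for [x],
    near which everything splits. *)
Lemma inherits_open l ls x :
  rel_open (chain_min ls) (chain_max ls) (splits ls) -> inherits l ls x ->
  exists d, 0 < d /\ forall y, Rabs (x - y) < d -> inherits l ls y.
Proof.
  intros ho hi; apply NNPP; intros hn.
  destruct (cluster_real (fun e r => exists y, Rabs (x - y) < e /\
     chain_min ls <= r <= chain_max ls /\ Rabs (y - l) <= r <= y + l /\
     ~ splits ls r) (Rabs (chain_min ls) + Rabs (chain_max ls))) as [r hr].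
  - intros e e' r he [y [h1 h]]; exists y; split; [lra | easy].
  - intros e he; apply NNPP; intros hm; apply hn; exists e; split; [easy |].
    intros y hy r h1 h2; apply NNPP; intros hs; apply hm.
    exists r; split; [case_abs; lra |]; exists y; auto.
  - assert (b : forall e, 0 < e -> chain_min ls - e <= r /\ r <= chain_max ls + e /\
        Rabs (x - l) - e <= r /\ r <= x + l + e).
    { intros e he; destruct (hr (e / 2) ltac:(lra)) as [z [hz [y [h1 [h2 [h3 _]]]]]].
      case_abs; lra. }
    assert (r1 : chain_min ls <= r) by (apply le_epsilon; intros e he; specialize (b e he); lra).
    assert (r2 : r <= chain_max ls) by (apply le_epsilon; intros e he; specialize (b e he); lra).
    assert (r3 : Rabs (x - l) <= r) by (apply le_epsilon; intros e he; specialize (b e he); lra).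
    assert (r4 : r <= x + l) by (apply le_epsilon; intros e he; specialize (b e he); lra).
    destruct (ho r) as [d [hd h]]; [lra | now apply hi |].
    destruct (hr d hd) as [z [hz [y [_ [h2 [_ h4]]]]]].
    apply h4, h; [easy | rewrite Rabs_minus_sym; easy].
Qed.

Lemma splits_open ls : rel_open (chain_min ls) (chain_max ls) (splits ls).
Proof.
  induction ls as [| l ls IH]; [easy |].
  intros x hx [h | h].
  - destruct (turns_open _ _ _ h) as [d [hd hy]]; exists d; split; [easy |].
    intros y _ hxy; left; auto.
  - destruct (inherits_open _ _ _ IH h) as [d [hd hy]]; exists d; split; [easy |].
    intros y _ hxy; right; now apply hy.
Qed.

Definition near_list (e : R) : list R2 -> list R2 -> Prop :=
  Forall2 (fun p q => pdist p q < e).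

Lemma near_list_weaken e e' ps qs : e <= e' -> near_list e ps qs -> near_list e' ps qs.
Proof.
  intros he; apply Forall2_impl; intros; lra.
Qed.

(** If [turns] or [inherits] holds for the limit, openness makes it hold for all close enough
    approximations, which then satisfy the corresponding constraint; that constraint is a closed
    condition and passes to the limit. *)
Lemma half_chain_closed s ls A B ps : all_nonneg ls -> chain ls A B ps ->
  (forall e, 0 < e -> exists A' B' ps', pdist A A' < e /\ pdist B B' < e /\
     near_list e ps ps' /\ half_chain s ls A' B' ps') ->
  half_chain s ls A B ps.
Proof.
  intros hn; revert A ps; induction hn as [| l ls hl hn IH]; intros A [| p ps];
    simpl; try tauto.
  intros [h1 h2] h; split; [easy | split; [easy |]].
  assert (hd : forall A' B' e, pdist A A' < e / 2 -> pdist B B' < e / 2 ->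
     Rabs (pdist A B - pdist A' B') < e).
  { intros A' B' e ha hb; pose proof (pdist_lipschitz A B A' B'); lra. }
  split.
  - intros ht; destruct (turns_open _ _ _ ht) as [d [d0 hopen]].
    apply Rnot_lt_le; intros hlt.
    assert (hc : 0 < Rabs (cross A B p)).
    { apply Rabs_pos_lt; intros h0; rewrite h0 in hlt; lra. }
    destruct (cross_continuous A B p _ hc) as [d' [d'0 hcont]].
    destruct (h (Rmin (d / 2) d')) as [A' [B' [[| p' ps'] [a1 [a2 [a3 a4]]]]]];
      [apply Rmin_glb_lt; lra | easy |].
    pose proof (Rmin_l (d / 2) d'); pose proof (Rmin_r (d / 2) d').
    destruct a4 as [_ [_ [a4 _]]].
    inversion a3; subst.
    specialize (a4 (hopen _ (hd A' B' d ltac:(lra) ltac:(lra)))).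
    specialize (hcont A' B' p' ltac:(lra) ltac:(lra) ltac:(lra)).
    destruct s; simpl in *; case_abs; lra.
  - intros hi; destruct (inherits_open _ _ _ (splits_open ls) hi) as [d [d0 hopen]].
    apply IH; [easy |]; intros e he.
    destruct (h (Rmin (d / 2) e)) as [A' [B' [[| p' ps'] [a1 [a2 [a3 a4]]]]]];
      [apply Rmin_glb_lt; lra | easy |].
    pose proof (Rmin_l (d / 2) e); pose proof (Rmin_r (d / 2) e).
    inversion a3; subst.
    exists p', B', ps'; split; [lra |]; split; [lra |]; split.
    + eapply near_list_weaken; [| eassumption]; easy.
    + destruct a4 as [_ [_ [_ a4]]]; apply a4, hopen, hd; lra.
Qed.

Lemma chain_rigid c s tx ty ls A B ps : c ^ 2 + s ^ 2 = 1 -> chain ls A B ps ->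
  chain ls (rigid c s tx ty A) (rigid c s tx ty B) (map (rigid c s tx ty) ps).
Proof.
  intros h; revert A ps; induction ls as [| l ls IH]; intros A [| p ps]; simpl; try easy.
  - now intros ->.
  - rewrite pdist_rigid by easy; intros []; auto.
Qed.

Lemma half_chain_rigid t c s tx ty ls A B ps : c ^ 2 + s ^ 2 = 1 ->
  half_chain t ls A B ps ->
  half_chain t ls (rigid c s tx ty A) (rigid c s tx ty B) (map (rigid c s tx ty) ps).
Proof.
  intros h; revert A ps; induction ls as [| l ls IH]; intros A [| p ps]; simpl; try easy.
  - now intros ->.
  - rewrite !pdist_rigid, cross_rigid by easy; intros [h1 [h2 [h3 h4]]].
    split; [| split; [| split]]; auto using chain_rigid.
Qed.

Lemma pdist_limit A p l :
  (forall e, 0 < e -> exists A' p', pdist A A' < e /\ pdist p p' < e /\ pdist A' p' = l) ->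
  pdist A p = l.
Proof.
  intros h.
  assert (hb : forall e, 0 < e -> Rabs (pdist A p - l) <= e).
  { intros e he; destruct (h (e / 2) ltac:(lra)) as [A' [p' [h1 [h2 h3]]]].
    pose proof (pdist_lipschitz A p A' p'); rewrite h3 in *; lra. }
  apply Rle_antisym; apply le_epsilon; intros e he; specialize (hb e he);
    case_abs; lra.
Qed.

(** Compactness of chains with converging ends: the fixed edge lengths bound the vertices, which are
    clustered one at a time. [Z] is any further property of the approximating chains, kept for later
    use. *)
Lemma chain_cluster ls A B (Z : R -> R2 -> R2 -> list R2 -> Prop) :
  (forall e e' A' B' qs, e <= e' -> Z e A' B' qs -> Z e' A' B' qs) ->
  (forall e, 0 < e -> exists A' B' qs, pdist A A' < e /\ pdist B B' < e /\
     chain ls A' B' qs /\ Z e A' B' qs) ->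
  exists ps, chain ls A B ps /\ forall e, 0 < e -> exists A' B' qs,
    pdist A A' < e /\ pdist B B' < e /\ near_list e ps qs /\
    chain ls A' B' qs /\ Z e A' B' qs.
Proof.
  revert A Z; induction ls as [| l ls IH]; intros A Z mono h.
  - exists []; split.
    + simpl; apply pdist_eq0, pdist_limit; intros e he.
      destruct (h e he) as [A' [B' [[| q qs] [h1 [h2 [h3 _]]]]]]; [| easy].
      simpl in h3; subst; exists B', B'; auto using pdist_refl.
    + intros e he; destruct (h e he) as [A' [B' [[| q qs] [h1 [h2 [h3 h4]]]]]]; [| easy].
      exists A', B', []; repeat split; auto; constructor.
  - destruct (cluster_point (fun e p => exists A' B' qs, pdist A A' < e /\
      pdist B B' < e /\ pdist A' p = l /\ chain ls p B' qs /\ Z e A' B' (p :: qs))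
      A (l + 1)) as [p hp].
    + intros e e' z he [A' [B' [qs [h1 [h2 [h3 [h4 h5]]]]]]].
      exists A', B', qs; repeat split; auto; try lra; eauto.
    + intros e he; destruct (h (Rmin e 1)) as [A' [B' [[| p qs] [h1 [h2 [h3 h4]]]]]];
        [apply Rmin_glb_lt; lra | easy |].
      pose proof (Rmin_l e 1); pose proof (Rmin_r e 1); destruct h3 as [h3 h3'].
      exists p; split; [pose proof (pdist_triangle A A' p); lra |].
      exists A', B', qs; repeat split; auto; try lra; eauto.
    (* The starting point already treated is stored in the property handed to the induction, so the
       same approximating chain serves for all vertices. *)
    + destruct (IH p (fun e p' B' qs => exists A', pdist A A' < e /\ pdist A' p' = l /\
         Z e A' B' (p' :: qs))) as [ps [h1 h2]].
      * intros e e' p' B' qs he [A' [a1 [a2 a3]]]; exists A'; repeat split; auto;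
          try lra; eauto.
      * intros e he; destruct (hp e he) as [p' [b1 [A' [B' [qs [b2 [b3 [b4 [b5 b6]]]]]]]]].
        exists p', B', qs; repeat split; auto; exists A'; auto.
      * exists (p :: ps); split; [split; [| easy] |].
        -- apply pdist_limit; intros e he.
           destruct (h2 e he) as [p' [B' [qs [c1 [_ [_ [_ [A' [c2 [c3 _]]]]]]]]]].
           exists A', p'; auto.
        -- intros e he.
           destruct (h2 e he) as [p' [B' [qs [c1 [c2 [c3 [c4 [A' [c5 [c6 c7]]]]]]]]]].
           exists A', B', (p' :: qs); repeat split; auto; constructor; auto.
Qed.

(** * Connectedness of the families *)

(* Connectedness of [S], as constancy of the locally constant predicates;
   [near e x y] reads "[y] is [e]-close to [x]". *)
Definition connected {X : Type} (near : R -> X -> X -> Prop) (S : X -> Prop) : Prop :=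
  forall U : X -> Prop,
    (forall x, S x -> exists e, 0 < e /\ forall y, S y -> near e x y -> (U x <-> U y)) ->
    forall x y, S x -> S y -> U x -> U y.

Definition near_point (e : R) (p q : R2) : Prop := pdist p q < e.

Lemma frame A B : exists c s, c ^ 2 + s ^ 2 = 1 /\
  fst B = fst A + pdist A B * c /\ snd B = snd A + pdist A B * s.
Proof.
  pose proof (pdist_sqr A B) as e.
  destruct (Req_dec (pdist A B) 0) as [h0 | h0].
  (* When [A = B] any axis will do. *)
  - exists 1, 0; rewrite h0; apply pdist_eq0 in h0; subst; lra.
  - exists ((fst B - fst A) / pdist A B), ((snd B - snd A) / pdist A B).
    split; [| split; field; easy].
    apply Rmult_eq_reg_l with (pdist A B ^ 2); [| now apply pow_nonzero].
    transitivity ((fst B - fst A) ^ 2 + (snd B - snd A) ^ 2); [field; easy |].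
    rewrite e; ring_simplify; lra.
Qed.

(* Half circle of radius [l] around [A], parametrized by the cosine [u] of the
   angle to the axis [(c, s)]; [t] selects the side. *)
Definition arc (A : R2) (c s l : R) (t : bool) (u : R) : R2 :=
  (fst A + l * (u * c + sg t * sqrt (1 - u ^ 2) * s),
   snd A + l * (u * s - sg t * sqrt (1 - u ^ 2) * c)).

Section Arc.
Variables (A B : R2) (c s l : R).
Hypothesis hcs : c ^ 2 + s ^ 2 = 1.
Hypothesis hB1 : fst B = fst A + pdist A B * c.
Hypothesis hB2 : snd B = snd A + pdist A B * s.
Hypothesis hl : 0 <= l.

Let x := pdist A B.

Lemma sqrt_1_sqr u : -1 <= u <= 1 -> sqrt (1 - u ^ 2) ^ 2 = 1 - u ^ 2.
Proof. intros hu; apply pow2_sqrt; nra. Qed.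

Lemma sg_sqr t : sg t ^ 2 = 1.
Proof. destruct t; simpl; ring. Qed.

Lemma arc_radius t u : -1 <= u <= 1 -> pdist A (arc A c s l t u) = l.
Proof.
  intros hu; apply pdist_eq_sqr; [easy |]; unfold arc; cbn [fst snd].
  transitivity (l ^ 2 * (u ^ 2 + sg t ^ 2 * sqrt (1 - u ^ 2) ^ 2) * (c ^ 2 + s ^ 2));
    [ring |].
  rewrite sqrt_1_sqr, sg_sqr, hcs by easy; ring.
Qed.

Lemma arc_cross t u : sg t * cross A B (arc A c s l t u) = l * x * sqrt (1 - u ^ 2).
Proof.
  unfold cross, arc; cbn [fst snd]; rewrite hB1, hB2; fold x.
  transitivity (sg t ^ 2 * (c ^ 2 + s ^ 2) * (l * x * sqrt (1 - u ^ 2))); [ring |].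
  rewrite sg_sqr, hcs; ring.
Qed.

Lemma arc_target t u : -1 <= u <= 1 ->
  pdist (arc A c s l t u) B ^ 2 = x ^ 2 + l ^ 2 - 2 * x * l * u.
Proof.
  intros hu; rewrite pdist_sqr; unfold arc; cbn [fst snd]; rewrite hB1, hB2; fold x.
  transitivity ((l ^ 2 * (u ^ 2 + sg t ^ 2 * sqrt (1 - u ^ 2) ^ 2) + x ^ 2 - 2 * x * l * u)
    * (c ^ 2 + s ^ 2)); [ring |].
  rewrite sqrt_1_sqr, sg_sqr, hcs by easy; ring.
Qed.

Lemma arc_surj p : pdist A p = l -> exists u t, -1 <= u <= 1 /\ p = arc A c s l t u.
Proof using hcs.
  clear hB1 hB2 hl x.
  intros hp; destruct (Req_dec l 0) as [h0 | h0].
  - rewrite h0 in *; apply pdist_eq0 in hp; subst p; exists 1, true; split; [lra |].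
    unfold arc; destruct A; simpl; f_equal; ring.
  - set (a := fst p - fst A); set (b := snd p - snd A).
    set (u := (a * c + b * s) / l); set (v := (a * s - b * c) / l).
    assert (huv : u ^ 2 + v ^ 2 = 1).
    { apply Rmult_eq_reg_l with (l ^ 2); [| now apply pow_nonzero].
      transitivity ((a ^ 2 + b ^ 2) * (c ^ 2 + s ^ 2)); [unfold u, v; field; easy |].
      rewrite hcs, <- hp, pdist_sqr; unfold a, b; ring. }
    assert (e1 : a = l * (u * c + v * s)).
    { transitivity (a * (c ^ 2 + s ^ 2)); [rewrite hcs; ring | unfold u, v; field; easy]. }
    assert (e2 : b = l * (u * s - v * c)).
    { transitivity (b * (c ^ 2 + s ^ 2)); [rewrite hcs; ring | unfold u, v; field; easy]. }
    assert (hu : -1 <= u <= 1) by nra.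
    assert (hv : 1 - u ^ 2 = v ^ 2) by lra.
    exists u; destruct (Rle_lt_dec 0 v) as [hv0 | hv0];
      [exists true | exists false]; (split; [easy |]); unfold arc; simpl sg;
      rewrite hv; [| replace (v ^ 2) with ((- v) ^ 2) by ring];
      rewrite sqrt_pow2 by lra; destruct p; simpl in *; unfold a, b in *; f_equal; nra.
Qed.

(** If the parametrization found for [p] uses the other side, the cross product vanishes; then the
    sine is zero and [p] is a point common to both half circles. *)
Lemma arc_surj_side t p : 0 < l -> 0 < x -> pdist A p = l -> 0 <= sg t * cross A B p ->
  exists u, -1 <= u <= 1 /\ p = arc A c s l t u.
Proof.
  intros l0 x0 hp hc; destruct (arc_surj p hp) as [u [t' [hu hpu]]].
  exists u; split; [easy |]; destruct (Bool.bool_dec t t') as [-> | ne]; [easy |].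
  assert (e : sg t = - sg t') by (destruct t, t'; simpl; lra || easy).
  pose proof (arc_cross t' u) as hc'; rewrite <- hpu in hc'.
  assert (sqrt (1 - u ^ 2) = 0).
  { pose proof (sqrt_pos (1 - u ^ 2)); rewrite e in hc.
    assert (0 < l * x) by now apply Rmult_lt_0_compat.
    nra. }
  rewrite hpu; unfold arc; f_equal; rewrite H; ring.
Qed.

Lemma arc_continuous t u e : -1 <= u <= 1 -> 0 < e -> exists d, 0 < d /\
  forall u', -1 <= u' <= 1 -> Rabs (u - u') < d ->
    pdist (arc A c s l t u) (arc A c s l t u') < e.
Proof.
  (* The sine is only Hölder of exponent 1/2 in the cosine near the ends of the arc: the squared
     distance is at most [4 * l ^ 2 * Rabs (u - u')]. The added 1 keeps the denominator positive for
     [l = 0]. *)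
  intros hu he; exists (e ^ 2 / (4 * l ^ 2 + 1)).
  assert (h1 : 0 < 4 * l ^ 2 + 1) by nra.
  split; [apply Rdiv_lt_0_compat; nra |].
  intros u' hu' hd.
  assert (hd' : 4 * l ^ 2 * Rabs (u - u') < e ^ 2).
  { apply Rmult_lt_compat_l with (r := 4 * l ^ 2 + 1) in hd; [| easy].
    replace ((4 * l ^ 2 + 1) * (e ^ 2 / (4 * l ^ 2 + 1))) with (e ^ 2) in hd by (field; lra).
    pose proof (Rabs_pos (u - u')); nra. }
  pose proof (pdist_ge0 (arc A c s l t u) (arc A c s l t u')).
  apply Rsqr_incrst_0; [| easy | lra].
  rewrite !Rsqr_pow2, pdist_sqr; unfold arc; cbn [fst snd].
  set (w := sqrt (1 - u ^ 2)); set (w' := sqrt (1 - u' ^ 2)).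
  assert (w2 : w ^ 2 = 1 - u ^ 2) by now apply sqrt_1_sqr.
  assert (w2' : w' ^ 2 = 1 - u' ^ 2) by now apply sqrt_1_sqr.
  assert (0 <= w) by apply sqrt_pos; assert (0 <= w') by apply sqrt_pos.
  assert (hw : (w - w') ^ 2 <= 2 * Rabs (u - u')).
  { assert ((w - w') ^ 2 <= Rabs (w ^ 2 - w' ^ 2)).
    { replace (w ^ 2 - w' ^ 2) with ((w - w') * (w + w')) by ring.
      rewrite Rabs_mult, (Rabs_pos_eq (w + w')), <- (pow2_abs (w - w')) by lra.
      assert (Rabs (w - w') <= w + w') by (case_abs; lra).
      pose proof (Rabs_pos (w - w')); nra. }
    rewrite w2, w2' in H2.
    replace (1 - u ^ 2 - (1 - u' ^ 2)) with (- ((u - u') * (u + u'))) in H2 by ring.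
    rewrite Rabs_Ropp, Rabs_mult in H2.
    assert (Rabs (u + u') <= 2) by (case_abs; lra).
    pose proof (Rabs_pos (u - u')); nra. }
  assert (hu2 : (u - u') ^ 2 <= 2 * Rabs (u - u')).
  { rewrite <- (pow2_abs (u - u')); assert (Rabs (u - u') <= 2) by (case_abs; lra).
    pose proof (Rabs_pos (u - u')); nra. }
  match goal with |- ?g < _ => replace g with
    (l ^ 2 * ((u - u') ^ 2 + sg t ^ 2 * (w - w') ^ 2) * (c ^ 2 + s ^ 2)) by ring end.
  rewrite hcs, sg_sqr; pose proof (pow2_ge_0 l); nra.
Qed.

(** By the law of cosines the distance to [B] is nonincreasing in the parameter, so the bounds [lo]
    and [hi] cut out an interval of parameters, and [interval_connected] applies. *)
Lemma arc_connected (lo hi : R) (t : bool) (G U : R2 -> Prop) : 0 <= lo ->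
  (forall u, -1 <= u <= 1 -> lo <= pdist (arc A c s l t u) B <= hi -> G (arc A c s l t u)) ->
  (forall p, G p -> exists e, 0 < e /\ forall q, G q -> near_point e p q -> (U p <-> U q)) ->
  forall u u', -1 <= u <= 1 -> -1 <= u' <= 1 ->
    lo <= pdist (arc A c s l t u) B <= hi -> lo <= pdist (arc A c s l t u') B <= hi ->
    U (arc A c s l t u) -> U (arc A c s l t u').
Proof.
  intros lo0 hG loc u u' hu hu' hr hr' hU.
  assert (anti : forall a b, -1 <= a <= 1 -> -1 <= b <= 1 -> a <= b ->
    pdist (arc A c s l t b) B <= pdist (arc A c s l t a) B).
  { intros a b ha hb hab; apply Rsqr_incr_0; try apply pdist_ge0.
    rewrite !Rsqr_pow2, !arc_target by easy.
    assert (0 <= x * l) by (apply Rmult_le_pos; [apply pdist_ge0 | easy]). nra. }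
  refine (interval_connected
    (fun v => -1 <= v <= 1 /\ lo <= pdist (arc A c s l t v) B <= hi)
    (fun v => U (arc A c s l t v)) _ _ u u' _ _ hU); auto.
  - intros a b v [ha ha'] [hb hb'] hv; assert (-1 <= v <= 1) by lra.
    split; [easy |].
    pose proof (anti a v ha H ltac:(lra)); pose proof (anti v b H hb ltac:(lra)); lra.
  - intros v [hv hv']; destruct (loc _ (hG v hv hv')) as [e [he hq]].
    destruct (arc_continuous t v e hv he) as [d [hd hc]].
    exists d; split; [easy |]; intros v' [h1 h2] h3; apply hq; auto; now apply hc.
Qed.

Lemma arc_exists t r : Rabs (x - l) <= r <= x + l ->
  exists u, -1 <= u <= 1 /\ pdist (arc A c s l t u) B = r.
Proof.
  intros hr.
  assert (hx : 0 <= x) by apply pdist_ge0.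
  assert (hr0 : 0 <= r) by (pose proof (Rabs_pos (x - l)); lra).
  (* In the degenerate case every parameter gives the distance [x + l]; otherwise the parameter is
     solved from the law of cosines. *)
  destruct (Req_dec (x * l) 0) as [h0 | h0].
  - exists 1; split; [lra |].
    apply Rsqr_inj; [apply pdist_ge0 | easy |].
    rewrite !Rsqr_pow2, arc_target by lra.
    apply Rmult_integral in h0; destruct h0 as [h0 | h0]; rewrite h0 in *;
      assert (r = x + l) by (case_abs; lra); rewrite H, h0; ring.
  - assert (h1 : 0 < x * l) by (pose proof (Rmult_le_pos _ _ hx hl); lra).
    assert (a1 : (x - l) ^ 2 <= r ^ 2) by (rewrite <- pow2_abs; apply pow_incr; split; [apply Rabs_pos | easy]).
    assert (a2 : r ^ 2 <= (x + l) ^ 2) by (apply pow_incr; easy).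
    set (u := (x ^ 2 + l ^ 2 - r ^ 2) / (2 * (x * l))).
    assert (e : 2 * (x * l) * u = x ^ 2 + l ^ 2 - r ^ 2)
      by (unfold u; field; split; intros z; rewrite z in h1; lra).
    assert (hu : -1 <= u <= 1) by (split; nra).
    exists u; split; [easy |].
    apply Rsqr_inj; [apply pdist_ge0 | easy |].
    rewrite !Rsqr_pow2, arc_target by easy; lra.
Qed.

End Arc.

Lemma circle_point A B l r t : 0 <= l ->
  Rabs (pdist A B - l) <= r <= pdist A B + l ->
  exists p, pdist A p = l /\ pdist p B = r /\ 0 <= sg t * cross A B p.
Proof.
  intros hl hr; destruct (frame A B) as [c [s [hcs [h1 h2]]]].
  destruct (arc_exists A B c s l hcs h1 h2 hl t r hr) as [u [hu e]].
  exists (arc A c s l t u); split; [now apply arc_radius | split; [easy |]].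
  rewrite (arc_cross A B) by easy.
  apply Rmult_le_pos; [apply Rmult_le_pos; [easy | apply pdist_ge0] | apply sqrt_pos].
Qed.

Lemma half_circle_connected A B l lo hi t : 0 < l -> 0 < pdist A B -> 0 <= lo ->
  connected near_point (fun p => pdist A p = l /\ lo <= pdist p B <= hi /\
    0 <= sg t * cross A B p).
Proof.
  intros hl hx hlo U loc p q [p1 [p2 p3]] [q1 [q2 q3]] hU.
  destruct (frame A B) as [c [s [hcs [h1 h2]]]].
  destruct (arc_surj_side A B c s l hcs h1 h2 t p hl hx p1 p3) as [u [hu ->]].
  destruct (arc_surj_side A B c s l hcs h1 h2 t q hl hx q1 q3) as [v [hv ->]].
  refine (arc_connected A B c s l hcs h1 h2 (Rlt_le _ _ hl) lo hi t _ U hlo _ loc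
    u v hu hv p2 q2 hU).
  intros w hw hw'; split; [apply arc_radius; lra | split; [easy |]].
  rewrite (arc_cross A B) by easy.
  apply Rmult_le_pos; [apply Rmult_le_pos; lra | apply sqrt_pos].
Qed.

(* The two half circles meet on the line [AB], at distance [|x - l|] or [x + l] of [B]. *)
Lemma circle_connected A B l lo hi : 0 <= l -> 0 <= lo ->
  lo <= Rabs (pdist A B - l) <= hi \/ lo <= pdist A B + l <= hi ->
  connected near_point (fun p => pdist A p = l /\ lo <= pdist p B <= hi).
Proof.
  intros hl hlo hend U loc p q [p1 p2] [q1 q2] hU.
  destruct (frame A B) as [c [s [hcs [h1 h2]]]].
  destruct (arc_surj A c s l hcs p p1) as [u [t [hu ->]]].
  destruct (arc_surj A c s l hcs q q1) as [v [t' [hv ->]]].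
  assert (conn : forall t u v, -1 <= u <= 1 -> -1 <= v <= 1 ->
    lo <= pdist (arc A c s l t u) B <= hi -> lo <= pdist (arc A c s l t v) B <= hi ->
    U (arc A c s l t u) -> U (arc A c s l t v)).
  { intros t0; refine (arc_connected A B c s l hcs h1 h2 hl lo hi t0 _ U hlo _ loc).
    intros w hw hw'; split; [apply arc_radius; lra | easy]. }
  assert (hx : 0 <= pdist A B) by apply pdist_ge0.
  assert (hz : exists z, -1 <= z <= 1 /\ arc A c s l t z = arc A c s l t' z /\
            lo <= pdist (arc A c s l t z) B <= hi).
  { assert (sq : forall z t0 t1, z ^ 2 = 1 -> arc A c s l t0 z = arc A c s l t1 z).
    { intros z t0 t1 e; unfold arc; rewrite e; replace (1 - 1) with 0 by ring.
      rewrite sqrt_0; f_equal; ring. }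
    destruct hend as [he | he]; [exists 1 | exists (-1)]; (split; [lra |]);
      (split; [apply sq; ring |]).
    - replace (pdist (arc A c s l t 1) B) with (Rabs (pdist A B - l)); [easy |].
      apply Rsqr_inj; [apply Rabs_pos | apply pdist_ge0 |].
      rewrite !Rsqr_pow2, pow2_abs, (arc_target A B) by (easy || lra); ring.
    - replace (pdist (arc A c s l t (-1)) B) with (pdist A B + l); [easy |].
      apply Rsqr_inj; [lra | apply pdist_ge0 |].
      rewrite !Rsqr_pow2, (arc_target A B) by (easy || lra); ring. }
  destruct hz as [z [hz1 [hz2 hz3]]].
  apply (conn t' z v); auto; [congruence |]; rewrite <- hz2; now apply (conn t u z).
Qed.

(* The projection to the first vertex is proper with connected fibres. *)
Lemma half_chains_over_connected t ls B (G : R2 -> Prop) : all_nonneg ls ->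
  connected near_point G ->
  (forall p, G p -> exists ps, half_chain t ls p B ps) ->
  (forall p, G p -> connected near_list (half_chain t ls p B)) ->
  connected near_list (fun ps => match ps with
    | [] => False | p :: ps' => G p /\ half_chain t ls p B ps' end).
Proof.
  intros hn hG hne hfib U loc [| p ps] [| q qs]; try easy.
  intros [gp hp] [gq hq] hU.
  assert (fib : forall p ps qs, G p -> half_chain t ls p B ps ->
     half_chain t ls p B qs -> U (p :: ps) -> U (p :: qs)).
  { intros p0 ps0 qs0 g0 h1 h2.
    refine (hfib p0 g0 (fun ps => U (p0 :: ps)) _ ps0 qs0 h1 h2).
    intros rs hrs; destruct (loc (p0 :: rs)) as [e [he h]]; [easy |].
    exists e; split; [easy |]; intros rs' h3 h4; apply h; [easy |].
    constructor; [now rewrite pdist_refl | easy]. }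
  (* Since the fibres are connected, [W p] also means that [U] holds for all the chains over [p]. *)
  set (W := fun p => exists ps, half_chain t ls p B ps /\ U (p :: ps)).
  assert (w : W q); [| destruct w as [rs [h1 h2]]; now apply (fib q rs)].
  apply (hG W) with (x := p); auto; [| now exists ps].
  clear p q ps qs gp hp gq hq hU; intros p gp.
  (* Properness: if [W] changed arbitrarily near [p], chains over nearby points that disagree with
     [W p] would cluster at a chain over [p], against the local constancy of [U] there. *)
  apply NNPP; intros hn'.
  destruct (chain_cluster ls p B (fun e p' B' qs => B' = B /\ G p' /\
     half_chain t ls p' B qs /\ ~ (W p <-> U (p' :: qs)))) as [ps [h1 h2]].
  - intros; tauto.
  - intros e he; apply NNPP; intros hm; apply hn'; exists e; split; [easy |].
    intros q gq hpq; destruct (hne q gq) as [qs hqs].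
    apply NNPP; intros hw; apply hm.
    exists q, B, qs; rewrite pdist_refl; repeat split; auto.
    + eapply half_chain_chain; eauto.
    + intros hU; apply hw; rewrite hU; split; intros hu.
      * now exists qs.
      * destruct hu as [rs [k1 k2]]; now apply (fib q rs).
  - assert (hps : half_chain t ls p B ps).
    { apply half_chain_closed; auto; intros e he.
      destruct (h2 e he) as [p' [B' [qs [k1 [k2 [k3 [_ [-> [_ [k4 _]]]]]]]]]].
      exists p', B, qs; auto. }
    destruct (loc (p :: ps)) as [e [he hl]]; [easy |].
    destruct (h2 e he) as [p' [B' [qs [k1 [k2 [k3 [_ [-> [k4 [k5 k6]]]]]]]]]].
    apply k6; rewrite <- (hl (p' :: qs)); [| easy | now constructor].
    split; intros hu; [destruct hu as [rs [m1 m2]]; now apply (fib p rs) | now exists ps].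
Qed.

(** The chains are fibred over the position of the first vertex. Under [turns] it runs over a piece
    of half circle and the remainder is arbitrary; under [inherits] it runs over a connected piece
    of the circle and the remainder stays in family [t]; in the last case it runs over such a piece
    and the remainder is arbitrary. An arbitrary remainder means two connected families, which are
    joined over a position where the remainder does not split. *)
Lemma half_chain_connected t ls A B : all_nonneg ls ->
  chain_min ls <= pdist A B <= chain_max ls ->
  (exists ps, half_chain t ls A B ps) /\ connected near_list (half_chain t ls A B).
Proof.
  intros hn; revert t A; induction hn as [| l ls hl hn IH]; intros t A hr.
  - simpl in hr; assert (h0 : pdist A B = 0) by lra; apply pdist_eq0 in h0.
    split; [now exists [] |].
    intros U _ [| p ps] [| q qs]; simpl; try easy.
  - set (x := pdist A B) in *.
    pose proof (chain_min_le_max ls hn) as hm.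
    assert (x0 : 0 <= x) by apply pdist_ge0.
    assert (j1 : Rabs (x - l) <= chain_max ls) by (simpl in hr; case_abs; case_max; lra).
    assert (j2 : chain_min ls <= x + l) by (simpl in hr; case_max; lra).
    (* [G]: the positions of the first vertex; [both]: whether both families of
       chains occur over it, or only the family [t]. *)
    assert (glue : forall (G : R2 -> Prop) (both : bool),
      (forall p, G p -> chain_min ls <= pdist p B <= chain_max ls) ->
      connected near_point G ->
      (exists p, G p /\ (both = true -> ~ splits ls (pdist p B))) ->
      (forall p ps, half_chain t (l :: ls) A B (p :: ps) <->
         G p /\ if both then chain ls p B ps else half_chain t ls p B ps) ->
      (exists ps, half_chain t (l :: ls) A B ps) /\
      connected near_list (half_chain t (l :: ls) A B)).
    { intros G both hGr hG [p0 [g0 hs0]] hiff.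
      destruct (IH t p0 (hGr p0 g0)) as [[ps0 hps0] _].
      split.
      { exists (p0 :: ps0); apply hiff; split; [easy |].
        destruct both; [eapply half_chain_chain; eauto | easy]. }
      assert (piece : forall t', (both = false -> t' = t) -> forall U,
        (forall ps, half_chain t (l :: ls) A B ps -> exists e, 0 < e /\
           forall qs, half_chain t (l :: ls) A B qs -> near_list e ps qs -> (U ps <-> U qs)) ->
        forall p ps q qs, G p -> G q -> half_chain t' ls p B ps ->
          half_chain t' ls q B qs -> U (p :: ps) -> U (q :: qs)).
      { intros t' ht' U loc p ps q qs gp gq hp hq.
        apply (half_chains_over_connected t' ls B G hn hG); auto.
        - intros r gr; now apply IH, hGr.
        - intros r gr; now apply IH, hGr.
        - assert (sub : forall rs, match rs with [] => False
              | r :: rs' => G r /\ half_chain t' ls r B rs' end ->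
              half_chain t (l :: ls) A B rs).
          { intros [| r rs]; [easy |]; intros [gr hrs]; apply hiff; split; [easy |].
            destruct both; [eapply half_chain_chain; eauto |].
            now rewrite <- ht'. }
          intros rs hrs; destruct (loc rs (sub rs hrs)) as [e [he h]].
          exists e; split; [easy |]; intros rs' hrs'; apply h; auto. }
      intros U loc [| p ps] [| q qs] hp hq; try easy.
      rewrite hiff in hp, hq; destruct hp as [gp hp], hq as [gq hq]; intros hU.
      destruct both; [| now apply (piece t (fun _ => eq_refl) U loc p ps)].
      assert (pc : forall t' p ps q qs, G p -> G q -> half_chain t' ls p B ps ->
          half_chain t' ls q B qs -> U (p :: ps) -> U (q :: qs))
        by (intros t'; apply piece; easy).
      (* The bridge: over [p0] the remainder does not split, so one chain belongs to both
         families. *)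
      assert (h0 : forall t', half_chain t' ls p0 B ps0).
      { intros t'; apply half_chain_both; [now apply hs0 |].
        eapply half_chain_chain; eauto. }
      assert (u0 : U (p0 :: ps0)).
      { destruct (chain_cover _ _ _ _ hn hp) as [hp' | hp'];
          [apply (pc true p ps) | apply (pc false p ps)]; auto. }
      destruct (chain_cover _ _ _ _ hn hq) as [hq' | hq'];
        [apply (pc true p0 ps0) | apply (pc false p0 ps0)]; auto. }
    destruct (classic (turns l ls x)) as [ht | ht].
    + pose proof (turns_inherits _ _ _ hn ht) as hni.
      pose proof ht as ht'; destruct ht' as [t1 t2].
      assert (l0 : 0 < l) by (case_abs; lra).
      assert (x1 : 0 < x) by (case_abs; lra).
      apply (glue (fun p => pdist A p = l /\ chain_min ls <= pdist p B <= chain_max ls /\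
        0 <= sg t * cross A B p) true).
      * intros; tauto.
      * apply half_circle_connected; [exact l0 | exact x1 | lra].
      (* The two families of remainders meet where the remainder is straight. *)
      * destruct (circle_point A B l (chain_max ls) t hl) as [p [p1 [p2 p3]]];
          [fold x; lra |].
        exists p; rewrite p2; repeat split; auto; try lra; intros _; now apply splits_max.
      * intros p ps; simpl; fold x; split; [| tauto].
        intros [k1 [k2 [k3 _]]]; pose proof (chain_range _ _ _ _ hn k2); auto.
    + assert (hG : connected near_point (fun p => pdist A p = l /\
        chain_min ls <= pdist p B <= chain_max ls)).
      (* The failure of [turns] says that a point of the circle on the line [AB] lies at a distance
         from [B] attainable by the remainder. *)
      { apply circle_connected; [easy | lra |]; fold x.
        unfold turns in ht; destruct (Rle_lt_dec (chain_min ls) (Rabs (x - l))); [lra |].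
        destruct (Rle_lt_dec (x + l) (chain_max ls)); lra. }
      destruct (classic (inherits l ls x)) as [hi | hi].
      * apply (glue (fun p => pdist A p = l /\ chain_min ls <= pdist p B <= chain_max ls) false);
          auto.
        -- intros; tauto.
        -- destruct (circle_point A B l (Rmax (Rabs (x - l)) (chain_min ls)) t hl)
             as [p [p1 [p2 p3]]].
           { fold x; assert (Rabs (x - l) <= x + l) by (case_abs; lra).
             split; [apply Rmax_l | apply Rmax_lub; lra]. }
           exists p; rewrite p2; repeat split; auto; try easy.
           ++ apply Rmax_r.
           ++ apply Rmax_lub; lra.
        -- intros p ps; simpl; fold x; split.
           ++ intros [k1 [k2 [_ k4]]]; pose proof (chain_range _ _ _ _ hn k2); auto.
           ++ intros [[k1 k2] k3]; repeat split; auto; [eapply half_chain_chain; eauto | easy].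
      * apply (glue (fun p => pdist A p = l /\ chain_min ls <= pdist p B <= chain_max ls) true);
          auto.
        -- intros; tauto.
        -- apply not_all_ex_not in hi; destruct hi as [r hi].
           apply imply_to_and in hi; destruct hi as [r1 hi].
           apply imply_to_and in hi; destruct hi as [r2 hi].
           destruct (circle_point A B l r t hl r2) as [p [p1 [p2 p3]]].
           exists p; rewrite p2; auto.
        -- intros p ps; simpl; fold x; split; [| tauto].
           intros [k1 [k2 _]]; pose proof (chain_range _ _ _ _ hn k2); auto.
Qed.

(** * Adding a path to a linkage *)

(* Configurations are handled as total functions [f : V -> R2], of which only
   the values on the vertex set [N] matter. *)
Definition near_on {V} (N : V -> Prop) (e : R) (f g : V -> R2) : Prop :=
  forall w, N w -> pdist (f w) (g w) < e.

Definition congruent_on {V} (N : V -> Prop) (f g : V -> R2) : Prop :=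
  exists c s tx ty, c ^ 2 + s ^ 2 = 1 /\
    forall w, N w -> g w = rigid c s tx ty (f w).

(* [M_connected], for a set [S] of total configurations. *)
Definition connected_mod {V} (N : V -> Prop) (S : (V -> R2) -> Prop) : Prop :=
  forall U : (V -> R2) -> Prop,
    (forall f g, S f -> S g -> congruent_on N f g -> U f -> U g) ->
    (forall f, S f -> exists e, 0 < e /\
       forall g, S g -> near_on N e f g -> (U f <-> U g)) ->
    forall f g, S f -> S g -> U f -> U g.

Definition invariant {V} (N : V -> Prop) (S : (V -> R2) -> Prop) : Prop :=
  forall f g, S f -> congruent_on N f g -> S g.

Lemma rigid_id z : rigid 1 0 0 0 z = z.
Proof. destruct z; unfold rigid; simpl; f_equal; ring. Qed.

Lemma congruent_on_eq {V} (N : V -> Prop) f g :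
  (forall w, N w -> f w = g w) -> congruent_on N f g.
Proof.
  intros h; exists 1, 0, 0, 0; split; [ring |].
  intros w hw; now rewrite rigid_id, h.
Qed.

Lemma connected_mod_ext {V} (N N' : V -> Prop) (S S' : (V -> R2) -> Prop) :
  (forall w, N w <-> N' w) -> (forall f, S f <-> S' f) ->
  connected_mod N S <-> connected_mod N' S'.
Proof.
  assert (main : forall (N N' : V -> Prop) (S S' : (V -> R2) -> Prop),
    (forall w, N w <-> N' w) -> (forall f, S f <-> S' f) ->
    connected_mod N S -> connected_mod N' S').
  { intros M M' T T' hM hT hc U sat loc f g hf hg.
    apply (hc U); [| | now apply hT | now apply hT].
    - intros f' g' hf' hg' [c [s [tx [ty [h1 h2]]]]]; apply sat; try now apply hT.
      exists c, s, tx, ty; split; [easy |]; intros w hw; apply h2; now apply hM.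
    - intros f' hf'; destruct (loc f') as [e [he h]]; [now apply hT |].
      exists e; split; [easy |]; intros g' hg' hn; apply h; [now apply hT |].
      intros w hw; apply hn; now apply hM. }
  intros hN hS; split; apply main; auto; intros; symmetry; auto.
Qed.

Fixpoint assign {V} (ws : list V) (ps : list R2) (f : V -> R2) (w : V) : R2 :=
  match ws, ps with
  | x :: ws', p :: ps' =>
      if excluded_middle_informative (w = x) then p else assign ws' ps' f w
  | _, _ => f w
  end.

Lemma assign_out {V} (ws : list V) ps f w : ~ In w ws -> assign ws ps f w = f w.
Proof.
  revert ps; induction ws as [| x ws IH]; intros [| p ps]; simpl; try easy.
  intros hw; destruct (excluded_middle_informative (w = x)); [subst; tauto |].
  apply IH; tauto.
Qed.

Lemma map_assign {V} (ws : list V) ps f : NoDup ws -> length ps = length ws ->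
  map (assign ws ps f) ws = ps.
Proof.
  intros hn; revert ps; induction hn as [| x ws hx hn IH]; intros [| p ps]; simpl;
    try easy.
  intros [=hl]; f_equal.
  - destruct (excluded_middle_informative (x = x)); easy.
  - transitivity (map (assign ws ps f) ws); [| now apply IH]; apply map_ext_in; intros w hw.
    destruct (excluded_middle_informative (w = x)); [subst; easy | easy].
Qed.

Lemma near_list_map {V} e (f g : V -> R2) ws :
  near_list e (map f ws) (map g ws) <-> forall w, In w ws -> pdist (f w) (g w) < e.
Proof.
  induction ws as [| x ws IH]; simpl; split.
  - easy.
  - constructor.
  - intros h; inversion h; subst; intros w [<- | hw]; [easy | now apply IH].
  - intros h; constructor; [auto | apply IH; auto].
Qed.

Section AddPath.
Variables (V : Type) (N : V -> Prop) (S : (V -> R2) -> Prop) (u v : V).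
Variables (ws : list V) (ls : list R).
Hypothesis hu : N u.
Hypothesis hv : N v.
Hypothesis hws : NoDup ws.
Hypothesis hfresh : forall w, In w ws -> ~ N w.
Hypothesis hlen : length ls = length (ws ++ [v]).
Hypothesis hls : all_nonneg ls.
Hypothesis hS : invariant N S.
Hypothesis hrange : forall f, S f -> chain_min ls <= pdist (f u) (f v) <= chain_max ls.

Let N' w := N w \/ In w ws.
Let T f := S f /\ chain ls (f u) (f v) (map f (ws ++ [v])).

Lemma assign_chain k ps : chain ls (k u) (k v) ps ->
  map (assign ws ps k) (ws ++ [v]) = ps.
Proof.
  intros h; destruct (chain_last ls (k u) (k v) ps) as [qs [-> e]].
  - intros h0; rewrite h0, length_app in hlen; simpl in hlen; lia.
  - easy.
  - rewrite hlen, !length_app in e; simpl in e.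
    assert (e' : length qs = length ws) by lia.
    (* The last point of the chain is the position of [v], which is not in [ws]; [assign] ignores it
       because [ws] is one shorter. *)
    assert (ha : forall w, assign ws (qs ++ [k v]) k w = assign ws qs k w).
    { clear - e'; intros w; revert qs e'; induction ws as [| x l IH]; intros [| q qs]; simpl; try easy.
      intros [=hl]; destruct (excluded_middle_informative (w = x)); auto. }
    rewrite (map_ext _ _ ha), map_app, map_assign by easy; simpl.
    now rewrite assign_out by (intros hw; now apply (hfresh v)).
Qed.

Lemma assign_base k ps w : N w -> assign ws ps k w = k w.
Proof. intros hw; apply assign_out; intros hi; now apply (hfresh w). Qed.

Lemma S_agree f g : S f -> (forall w, N w -> f w = g w) -> S g.
Proof. intros hf h; apply (hS f); [easy | now apply congruent_on_eq]. Qed.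

Lemma half_lift t k : S k -> exists f, S f /\ (forall w, N w -> f w = k w) /\
  half_chain t ls (f u) (f v) (map f (ws ++ [v])).
Proof.
  intros hk; destruct (half_chain_connected t ls (k u) (k v) hls (hrange k hk))
    as [[ps hps] _].
  exists (assign ws ps k); split.
  - apply (S_agree k); auto; intros; now rewrite assign_base.
  - split; [intros; now apply assign_base |].
    rewrite assign_chain by (eapply half_chain_chain; eauto).
    now rewrite !assign_base.
Qed.

Lemma add_path_lift k : S k -> exists f, T f /\ forall w, N w -> f w = k w.
Proof.
  intros hk; destruct (half_lift true k hk) as [f [h1 [h2 h3]]].
  exists f; repeat split; auto; eapply half_chain_chain; eauto.
Qed.

Lemma add_path_invariant : invariant N' T.
Proof.
  intros f g [h1 h2] [c [s [tx [ty [e h]]]]]; split.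
  - apply (hS f); [easy |]; exists c, s, tx, ty; split; [easy |].
    intros w hw; apply h; now left.
  - rewrite !h by (now left).
    replace (map g (ws ++ [v])) with (map (rigid c s tx ty) (map f (ws ++ [v])));
      [now apply chain_rigid |].
    rewrite map_map; apply map_ext_in; intros w hw; rewrite h; [easy |].
    apply in_app_or in hw; destruct hw as [hw | [<- | []]]; [now right | now left].
Qed.

(** The restriction from [T] to [S] is continuous, compatible with congruence and, by
    [add_path_lift], surjective. *)
Lemma remove_path_connected : connected_mod N' T -> connected_mod N S.
Proof.
  intros hT U sat loc f g hf hg hU.
  assert (ext : forall f g, S f -> (forall w, N w -> f w = g w) -> U f -> U g).
  { intros f0 g0 h1 h2; apply sat; [easy | now apply (S_agree f0) |].
    now apply congruent_on_eq. }
  destruct (add_path_lift f hf) as [f' [tf ef]], (add_path_lift g hg) as [g' [tg eg]].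
  apply (ext g'); [apply tg | easy |].
  apply (hT U) with (f := f'); auto.
  - intros f0 g0 [h1 _] [h2 _] [c [s [tx [ty [e h]]]]]; apply sat; auto.
    exists c, s, tx, ty; split; [easy |]; intros w hw; apply h; now left.
  - intros f0 [h1 _]; destruct (loc f0 h1) as [e [he h]]; exists e; split; [easy |].
    intros g0 [h2 _] hn; apply h; [easy |]; intros w hw; apply hn; now left.
  - apply (ext f); auto; intros; symmetry; auto.
Qed.

(** Each family [H t] is proper over [S] with connected nonempty fibres, hence connected modulo
    congruence. A lift of the given [k] lies in both families, which together exhaust [T]. *)
Lemma add_path_connected : (exists k, S k /\ ~ splits ls (pdist (k u) (k v))) ->
  connected_mod N S -> connected_mod N' T.
Proof.
  intros [k0 [hk0 hs0]] hconn U sat loc.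
  assert (ext : forall f g, T f -> (forall w, N' w -> f w = g w) -> T g).
  { intros f g hf h; apply (add_path_invariant f); [easy | now apply congruent_on_eq]. }
  assert (Uext : forall f g, T f -> (forall w, N' w -> f w = g w) -> U f -> U g).
  { intros f g hf h; apply sat; [easy | now apply (ext f) | now apply congruent_on_eq]. }
  assert (cut : forall f g : V -> R2, (forall w, N w -> f w = g w) ->
     map f (ws ++ [v]) = map g (ws ++ [v]) -> forall w, N' w -> f w = g w).
  { intros f g h1 h2 w [hw | hw]; [auto |].
    rewrite !map_app in h2; apply app_inj_tail in h2; destruct h2 as [h3 _].
    clear - h3 hw; induction ws as [| x l IH]; simpl in *; [easy |].
    injection h3; intros; destruct hw as [<- | hw]; auto. }
  set (H t f := half_chain t ls (f u) (f v) (map f (ws ++ [v]))).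
  assert (HT : forall t f, S f -> H t f -> T f).
  { intros t f h1 h2; split; [easy | eapply half_chain_chain; eauto]. }
  assert (fib : forall t f g, S f -> (forall w, N w -> f w = g w) -> H t f -> H t g ->
    U f -> U g).
  { intros t f g hf efg h1 h2.
    assert (hg : S g) by now apply (S_agree f).
    destruct (half_chain_connected t ls (f u) (f v) hls (hrange f hf)) as [_ hc].
    assert (a1 : forall ps, half_chain t ls (f u) (f v) ps -> T (assign ws ps f) /\
      map (assign ws ps f) (ws ++ [v]) = ps).
    { intros ps hps; apply half_chain_chain in hps; split; [split |].
      - apply (S_agree f); auto; intros; now rewrite assign_base.
      - now rewrite assign_chain, !assign_base.
      - now apply assign_chain. }
    unfold H in h2; rewrite <- !efg in h2 by easy.
    intros hU.
    assert (hU' : U (assign ws (map g (ws ++ [v])) f)).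
    { apply (hc (fun ps => U (assign ws ps f))) with (x := map f (ws ++ [v])); auto.
      - intros ps hps; destruct (a1 ps hps) as [tp ep].
        destruct (loc _ tp) as [e [he hl]]; exists e; split; [easy |].
        intros qs hqs hnear; destruct (a1 qs hqs) as [tq eq]; apply hl; [easy |].
        intros w [hw | hw]; [rewrite !assign_base by easy; now rewrite pdist_refl |].
        rewrite <- ep, <- eq, near_list_map in hnear at 1.
        apply hnear; rewrite in_app_iff; now left.
      - apply (Uext f); auto; [now apply (HT t) |]; apply cut.
        + intros; now rewrite assign_base.
        + symmetry; now apply a1. }
    revert hU'; apply Uext; [now apply a1 |]; apply cut; [| now apply a1].
    intros; rewrite assign_base; auto. }
  (* The predicate that [U] induces on the base through family [t]; by [fib] it does not depend on
     the lift. *)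
  set (W t k := exists f, S f /\ (forall w, N w -> f w = k w) /\ H t f /\ U f).
  assert (WU : forall t f, S f -> H t f -> (W t f <-> U f)).
  { intros t f hf hh; split.
    - intros [g [h1 [h2 [h3 h4]]]]; now apply (fib t g).
    - intros hU; exists f; auto. }
  assert (half : forall t f g, S f -> S g -> H t f -> H t g -> U f -> U g).
  { intros t f g hf hg h1 h2 hU; apply (WU t); auto.
    apply (hconn (W t)) with (f := f); auto; [| | now apply WU].
    (* The isometry carrying [k] to [k'] is applied to the whole lift; it preserves orientation,
       hence the family. *)
    - intros k k' hk hk' [c [s [tx [ty [e h]]]]] [f0 [b1 [b2 [b3 b4]]]].
      set (f1 := fun w => rigid c s tx ty (f0 w)).
      assert (ef : forall w, N w -> f1 w = k' w).
      { intros w hw; unfold f1; rewrite b2, h; easy. }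
      assert (s1 : S f1) by (apply (S_agree k'); auto; intros; symmetry; auto).
      assert (h1' : H t f1).
      { unfold H, f1; rewrite <- map_map; now apply half_chain_rigid. }
      exists f1; split; [easy | split; [easy | split; [easy |]]].
      apply (sat f0); auto; [now apply (HT t) | now apply (HT t) |].
      exists c, s, tx, ty; split; [easy |]; reflexivity.
    (* Lifts over configurations tending to [k] at which [W t] changes would cluster at a lift of
       [k] in the same closed family, contradicting the local constancy of [U]. *)
    - intros k hk; apply NNPP; intros hn.
      destruct (chain_cluster ls (k u) (k v) (fun e A' B' qs => exists f',
         S f' /\ near_on N e k f' /\ f' u = A' /\ f' v = B' /\
         map f' (ws ++ [v]) = qs /\ H t f' /\ ~ (W t k <-> U f'))) as [ps [c1 c2]].
      + intros e e' A' B' qs he [f' [d1 [d2 [d3 [d4 [d5 d6]]]]]].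
        exists f'; repeat split; try apply d6; auto.
        intros w hw; specialize (d2 w hw); lra.
      + intros e he; apply NNPP; intros hm; apply hn; exists e; split; [easy |].
        intros k' hk' hnear; destruct (half_lift t k' hk') as [f' [l1 [l2 l3]]].
        apply NNPP; intros hw; apply hm.
        exists (f' u), (f' v), (map f' (ws ++ [v])).
        rewrite !l2 by easy; split; [now apply hnear | split; [now apply hnear |]].
        split; [rewrite <- !l2 by easy; eapply half_chain_chain; eauto |].
        exists f'; repeat split; auto.
        * intros w hw'; rewrite l2; auto.
        * intros hU'; apply hw.
          assert (hWk : W t k' <-> U f'); [| tauto].
          split; [intros [g0 [m1 [m2 [m3 m4]]]] | intros m; now exists f'].
          apply (fib t g0); auto; intros w hw'; rewrite m2, l2; auto.
      + set (f0 := assign ws ps k).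
        assert (e0 : forall w, N w -> f0 w = k w) by (intros; now apply assign_base).
        assert (em : map f0 (ws ++ [v]) = ps) by now apply assign_chain.
        assert (s0 : S f0) by (apply (S_agree k); auto; intros; symmetry; auto).
        assert (hh : H t f0).
        { unfold H; rewrite !e0, em by easy; apply half_chain_closed; auto.
          intros e he; destruct (c2 e he) as [A' [B' [qs [n1 [n2 [n3 [_ [f' n4]]]]]]]].
          destruct n4 as [_ [_ [<- [<- [<- [n4 _]]]]]].
          exists (f' u), (f' v), (map f' (ws ++ [v])); auto. }
        destruct (loc f0 (HT t f0 s0 hh)) as [e [he hl]].
        destruct (c2 e he) as [A' [B' [qs [n1 [n2 [n3 [_ [f' n4]]]]]]]].
        destruct n4 as [n4 [n5 [_ [_ [<- [n6 n7]]]]]]; apply n7.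
        rewrite <- (hl f' (HT t f' n4 n6)).
        * assert (hWk : W t k <-> W t f0); [| rewrite hWk; now apply WU].
          split; intros [g0 [m1 [m2 m3]]]; exists g0; repeat split; try apply m3; auto;
            intros w hw'; rewrite m2, e0; auto.
        * intros w [hw | hw]; [rewrite e0; auto |].
          rewrite <- em, near_list_map in n3; apply n3; rewrite in_app_iff; now left. }
  destruct (half_lift true k0 hk0) as [f0 [s0 [e0 h0]]].
  assert (hh : forall t, H t f0).
  { intros t; apply half_chain_both; [now rewrite !e0 |].
    eapply half_chain_chain; eauto. }
  intros f g [sf tf] [sg tg] hU.
  assert (u0 : U f0).
  { destruct (chain_cover _ _ _ _ hls tf); [apply (half true f) | apply (half false f)]; auto. }
  destruct (chain_cover _ _ _ _ hls tg); [apply (half true f0) | apply (half false f0)]; auto.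
Qed.

End AddPath.

(** * Linkage configurations as total functions *)

Definition sat {V} (E : list (edge V)) (f : V -> R2) : Prop :=
  forall x y l, In (x, y, l) E -> pdist (f x) (f y) = l.

Definition verts {V} (E : list (edge V)) (w : V) : Prop := In w (vertsOf E).

Lemma edge_verts {V} (E : list (edge V)) x y l :
  In (x, y, l) E -> verts E x /\ verts E y.
Proof.
  intros h; split; apply in_flat_map; exists (x, y, l); simpl; auto.
Qed.

Lemma vertsOf_app {V} (E E' : list (edge V)) : vertsOf (E ++ E') = vertsOf E ++ vertsOf E'.
Proof. apply flat_map_app. Qed.

Lemma sat_app {V} (E E' : list (edge V)) f : sat (E ++ E') f <-> sat E f /\ sat E' f.
Proof.
  split.
  - intros h; split; intros x y l hi; apply h, in_or_app; auto.
  - intros [h h'] x y l hi; apply in_app_or in hi; destruct hi; auto.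
Qed.

Lemma sat_invariant {V} (E : list (edge V)) (N : V -> Prop) :
  (forall w, verts E w -> N w) -> invariant N (sat E).
Proof.
  intros hN f g hf [c [s [tx [ty [e h]]]]] x y l hi.
  destruct (edge_verts E x y l hi).
  rewrite !h, pdist_rigid by auto; now apply hf.
Qed.

Section Configurations.
Variables (V : Type) (E : list (edge V)).

Definition restrict (f : V -> R2) : config E := fun x => f (proj1_sig x).

(** The value off the vertex set is arbitrary: constraints, congruence and closeness look only at
    vertices. *)
Definition extend (p : config E) (w : V) : R2 :=
  match excluded_middle_informative (In w (vertsOf E)) with
  | left h => p (exist _ w h)
  | right _ => (0, 0)
  end.

Lemma extend_val p x : extend p (proj1_sig x) = p x.
Proof.
  unfold extend; destruct x as [w h]; simpl.
  destruct (excluded_middle_informative _) as [h' |]; [| easy].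
  now rewrite (proof_irrelevance _ h' h).
Qed.

Lemma inC_extend p : inC E p <-> sat E (extend p).
Proof.
  split.
  - intros h x y l hi; destruct (edge_verts E x y l hi) as [hx hy].
    pose proof (extend_val p (exist _ x hx)) as e1.
    pose proof (extend_val p (exist _ y hy)) as e2.
    simpl in e1, e2; rewrite e1, e2; now apply h.
  - intros h x y l hi; rewrite <- !extend_val; now apply h.
Qed.

Lemma inC_restrict f : inC E (restrict f) <-> sat E f.
Proof.
  split.
  - intros h x y l hi; destruct (edge_verts E x y l hi) as [hx hy].
    exact (h (exist _ x hx) (exist _ y hy) l hi).
  - intros h x y l hi; now apply h.
Qed.

Lemma congruent_extend p q : congruent E p q -> congruent_on (verts E) (extend p) (extend q).
Proof.
  intros [c [s [tx [ty [e h]]]]]; exists c, s, tx, ty; split; [easy |].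
  intros w hw; pose proof (h (exist _ w hw)) as hh.
  now rewrite <- !extend_val in hh.
Qed.

Lemma near_extend e p q :
  (forall w, pdist (p w) (q w) < e) -> near_on (verts E) e (extend p) (extend q).
Proof.
  intros h w hw; pose proof (h (exist _ w hw)) as hh.
  now rewrite <- !extend_val in hh.
Qed.

Lemma dist_at_extend p u v x : dist_at E p u v x <->
  verts E u /\ verts E v /\ pdist (extend p u) (extend p v) = x.
Proof.
  split.
  - intros [[u' hu] [[v' hv] [e1 [e2 e3]]]]; simpl in *; subst.
    rewrite <- !extend_val; simpl; auto.
  - intros [hu [hv h]]; exists (exist _ u hu), (exist _ v hv).
    rewrite <- !extend_val; auto.
Qed.

Lemma extend_restrict f w : verts E w -> extend (restrict f) w = f w.
Proof.
  intros hw; exact (extend_val (restrict f) (exist _ w hw)).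
Qed.

(** A locally constant saturated predicate and its complement form a separation into open sets;
    conversely, one member of a separation is such a predicate. *)
Lemma M_connected_total : M_connected E <-> connected_mod (verts E) (sat E).
Proof.
  split.
  - intros hM U inv loc f g hf hg hU; apply NNPP; intros hn; apply hM.
    assert (tr : forall f, sat E f -> (U (extend (restrict f)) <-> U f)).
    { intros f' hf'.
      assert (hr : sat E (extend (restrict f'))) by now apply inC_extend, inC_restrict.
      split; apply inv; auto; apply congruent_on_eq; intros;
        [| symmetry]; now apply extend_restrict. }
    exists (fun p => U (extend p)), (fun p => ~ U (extend p)); repeat split.
    + intros p q hp hq hc; apply inv; try now apply inC_extend.
      now apply congruent_extend.
    + intros p hp hu; destruct (loc (extend p)) as [e [he h]]; [now apply inC_extend |].
      exists e; split; [easy |]; intros q hq hn'; apply (h (extend q)); auto;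
        [now apply inC_extend | now apply near_extend].
    + intros p q hp hq [c [s [tx [ty [e h]]]]] hu hu'; apply hu; revert hu'.
      apply inv; try now apply inC_extend.
      (* The inverse isometry; saturation of the complement needs congruence to be symmetric. *)
      apply congruent_extend; exists c, (- s), (- (c * tx + s * ty)), (s * tx - c * ty).
      split; [rewrite <- e; ring |]; intros w; rewrite h.
      unfold rigid; destruct (p w) as [p1 p2]; simpl.
      f_equal; ring_simplify; [transitivity ((c ^ 2 + s ^ 2) * p1) |
        transitivity ((c ^ 2 + s ^ 2) * p2)]; (rewrite e; ring) || ring.
    + intros p hp hu; destruct (loc (extend p)) as [e [he h]]; [now apply inC_extend |].
      exists e; split; [easy |]; intros q hq hn' hu'; apply hu, (h (extend q)); auto;
        [now apply inC_extend | now apply near_extend].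
    + intros p _; apply classic.
    + intros p _ h1 h2; auto.
    + exists (restrict f); split; [now apply inC_restrict | now apply tr].
    + exists (restrict g); split; [now apply inC_restrict | now rewrite tr].
  - intros hc [U1 [U2 [[o1 o1'] [[o2 o2'] [cov [dis [[p [hp hp']] [q [hq hq']]]]]]]]].
    assert (tr : forall (U : config E -> Prop) p, qopen E U -> inC E p ->
       (U p <-> U (restrict (extend p)))).
    { intros U p0 [op _] h.
      assert (h' : inC E (restrict (extend p0))) by now apply inC_restrict, inC_extend.
      assert (ee : forall w, restrict (extend p0) w = p0 w) by (intros; apply extend_val).
      split; apply op; auto; exists 1, 0, 0, 0; (split; [ring |]);
        intros w; rewrite rigid_id, ee; easy. }
    apply (dis q hq); [| easy].
    apply (tr U1 q); [now split | easy |].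
    apply (hc (fun f => U1 (restrict f))) with (f := extend p).
    + intros f g hf hg [c [s [tx [ty [e h]]]]]; apply o1; try now apply inC_restrict.
      exists c, s, tx, ty; split; [easy |]; intros [w hw]; unfold restrict; simpl; auto.
    + intros f hf; apply inC_restrict in hf.
      assert (hn : forall e g, near_on (verts E) e f g ->
        forall w, pdist (restrict f w) (restrict g w) < e)
        by (intros e g hn [w hw]; apply hn, hw).
      destruct (cov _ hf) as [h1 | h2].
      * destruct (o1' _ hf h1) as [e [he h]]; exists e; split; [easy |].
        intros g hg hfg; apply inC_restrict in hg.
        split; [| easy]; intros _; apply h; auto.
      * destruct (o2' _ hf h2) as [e [he h]]; exists e; split; [easy |].
        intros g hg hfg; apply inC_restrict in hg.
        split; intros h'; exfalso; [now apply (dis _ hf) |].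
        apply (dis _ hg h'), h; auto.
    + now apply inC_extend.
    + now apply inC_extend.
    + apply (tr U1 p); [now split | easy | easy].
Qed.

End Configurations.

(** * Path linkages and their splitting distances *)

(** In [is_path_graph] the edges are stored in order and oriented from [s] to [t], so the second
    endpoints are the internal vertices followed by the terminal [t]. *)
Definition inner {V} (P : list (edge V)) : list V :=
  removelast (map (fun e => snd (fst e)) P).

Lemma path_pairs_verts {V} (P : list (edge V)) x vs : map (fun e => fst e) P = path_pairs x vs ->
  map (fun e => snd (fst e)) P = vs.
Proof.
  revert x P; induction vs as [| y vs IH]; intros x [| e P]; simpl; try easy.
  intros [=h1 h2]; rewrite h1; f_equal; eauto.
Qed.

Lemma path_inner {V} (P : list (edge V)) u v : is_path_graph P u v ->
  NoDup (u :: v :: inner P) /\ map (fun e => fst e) P = path_pairs u (inner P ++ [v]).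
Proof.
  intros [ws [h1 h2]]; unfold inner; rewrite (path_pairs_verts _ _ _ h2).
  rewrite removelast_last; auto.
Qed.

Lemma path_vertsOf {V} (P : list (edge V)) x vs w : vs <> [] ->
  map (fun e => fst e) P = path_pairs x vs -> (verts P w <-> In w (x :: vs)).
Proof.
  revert x P; induction vs as [| y vs IH]; intros x [| e P] hne; simpl; try easy.
  intros [=h1 h2]; unfold verts; simpl; rewrite h1; simpl.
  destruct vs as [| z vs].
  - destruct P; simpl in *; [tauto | easy].
  - specialize (IH y P); unfold verts in IH; simpl in *; rewrite IH by easy; tauto.
Qed.

Lemma path_verts {V} (P : list (edge V)) u v w : is_path_graph P u v ->
  (verts P w <-> w = u \/ w = v \/ In w (inner P)).
Proof.
  intros h; apply path_inner in h; destruct h as [_ h].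
  rewrite (path_vertsOf P u (inner P ++ [v]) w);
    [| destruct (inner P); discriminate | easy].
  simpl; rewrite in_app_iff; simpl; split; intros hh.
  - destruct hh as [-> | [hh | [-> | []]]]; auto.
  - destruct hh as [-> | [-> | hh]]; auto.
Qed.

Lemma sat_path_pairs {V} (P : list (edge V)) x vs f :
  map (fun e => fst e) P = path_pairs x vs ->
  (sat P f <-> chain (map snd P) (f x) (f (last vs x)) (map f vs)).
Proof.
  revert x P; induction vs as [| y vs IH]; intros x [| e P];
    try (intros h; discriminate h).
  - intros _; split; [reflexivity | intros _ a b l []].
  - intros h; simpl in h; injection h; intros h2 h1.
    replace (last (y :: vs) x) with (last vs y)
      by (destruct vs as [| z vs]; [easy |]; change (last (y :: z :: vs) x)
          with (last (z :: vs) x); clear; revert z;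
          induction vs as [| t vs IHv]; intros z; [easy | apply (IHv t)]).
    simpl; rewrite <- (IH y P h2).
    destruct e as [[a b] l]; simpl in *; injection h1; intros -> ->.
    split.
    + intros hs; split; [apply hs; now left |]; intros a b' l' hi; apply hs; now right.
    + intros [hd hs] a b' l' [[= <- <- <-] | hi]; auto.
Qed.

Lemma sat_path {V} (P : list (edge V)) u v f : is_path_graph P u v ->
  (sat P f <-> chain (map snd P) (f u) (f v) (map f (inner P ++ [v]))).
Proof.
  intros h; apply path_inner in h; destruct h as [_ h].
  rewrite (sat_path_pairs P u _ f h), last_last; easy.
Qed.

Lemma path_length {V} (P : list (edge V)) u v : is_path_graph P u v ->
  length (map snd P) = length (inner P ++ [v]).
Proof.
  intros h; apply path_inner in h; destruct h as [_ h].
  apply path_pairs_verts in h; rewrite <- h, !length_map; easy.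
Qed.

Section Path.
Variables (V : Type) (P : list (edge V)) (u v : V).
Hypothesis hP : is_path_graph P u v.
Hypothesis hpos : all_nonneg (map snd P).
Let ls := map snd P.

Lemma path_ends : verts P u /\ verts P v.
Proof. rewrite !(path_verts P u v) by easy; auto. Qed.

Lemma path_realize t x : chain_min ls <= x <= chain_max ls ->
  exists f, sat P f /\ pdist (f u) (f v) = x /\
    half_chain t ls (f u) (f v) (map f (inner P ++ [v])).
Proof.
  intros hx; destruct (path_inner P u v hP) as [hn _].
  inversion hn as [| ? ? n1 n2]; inversion n2 as [| ? ? n3 n4]; subst.
  pose proof (chain_min_le_max ls hpos).
  (* The path is added to a base made of the two terminals alone, placed at [(0, 0)] and
     [(x, 0)]. *)
  destruct (half_lift V (fun w => w = u \/ w = v) (fun f => pdist (f u) (f v) = x)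
    u v (inner P) ls) with (t := t)
    (k := fun w : V => if excluded_middle_informative (w = v) then (x, 0) else (0, 0))
    as [f [h1 [h2 h3]]]; auto.
  - intros w hw [-> | ->]; [apply n1; now right | now apply n3].
  - now apply (path_length P u v).
  - intros f g hf [c [s [tx [ty [e h]]]]]; rewrite !h, pdist_rigid; auto.
  - intros f ->; easy.
  - destruct (excluded_middle_informative (u = v)); [subst; exfalso; apply n1; now left |].
    destruct (excluded_middle_informative (v = v)); [| easy].
    apply pdist_eq_sqr; simpl; [lra | ring].
  - exists f; repeat split; auto; apply (sat_path P u v); auto.
    eapply half_chain_chain; eauto.
Qed.

Lemma path_distRange x : distRange P u v x <-> chain_min ls <= x <= chain_max ls.
Proof.
  split.
  - intros [p [hp hd]]; apply dist_at_extend in hd; destruct hd as [_ [_ <-]].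
    apply inC_extend, (sat_path P u v) in hp; auto.
    now apply chain_range in hp.
  - intros hx; destruct (path_realize true x hx) as [f [h1 [h2 _]]].
    exists (restrict V P f); split; [now apply inC_restrict |].
    destruct path_ends; apply dist_at_extend; rewrite !extend_restrict; auto.
Qed.

(** At a splitting distance the complements of the two families separate the fibre: they are open
    since the families are closed, cover it since no chain there is in both, are disjoint since
    every chain is in one, and meet it since both families are inhabited. *)
Lemma nabla_not_splits x : nabla P u v x -> ~ splits ls x.
Proof.
  intros [hr hc] hs; apply path_distRange in hr.
  destruct path_ends as [hu hv].
  set (dd p := pdist (extend V P p u) (extend V P p v)).
  set (H t p := half_chain t ls (extend V P p u) (extend V P p v)
                  (map (extend V P p) (inner P ++ [v]))).
  assert (hch : forall p, inC P p -> chain ls (extend V P p u) (extend V P p v)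
                  (map (extend V P p) (inner P ++ [v]))).
  { intros p hp; apply (sat_path P u v), inC_extend; auto. }
  assert (hin : forall w, In w (inner P ++ [v]) -> verts P w).
  { intros w hw; rewrite (path_verts P u v) by easy.
    apply in_app_or in hw; destruct hw as [hw | [<- | []]]; auto. }
  assert (op : forall t, qopen P (fun p => splits ls (dd p) /\ ~ H t p)).
  { intros t; split.
    - intros p q hp hq hpq [h1 h2].
      apply congruent_extend in hpq; destruct hpq as [c [s [tx [ty [e h]]]]].
      unfold dd, H in *; split; [rewrite !h, pdist_rigid by easy; easy |].
      intros h3; apply h2.
      apply (half_chain_rigid t c (- s) (- (c * tx + s * ty)) (s * tx - c * ty)) in h3;
        [| rewrite <- e; ring].
      assert (back : forall w, verts P w ->
        rigid c (- s) (- (c * tx + s * ty)) (s * tx - c * ty) (extend V P q w) = extend V P p w).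
      { intros w hw; rewrite h by easy; unfold rigid.
        destruct (extend V P p w) as [p1 p2]; simpl.
        f_equal; ring_simplify; [transitivity ((c ^ 2 + s ^ 2) * p1) |
          transitivity ((c ^ 2 + s ^ 2) * p2)]; (rewrite e; ring) || ring. }
      rewrite map_map, !back in h3 by easy.
      erewrite map_ext_in in h3; [exact h3 |]; intros w hw; simpl; auto.
    - intros p hp [h1 h2].
      pose proof (chain_range _ _ _ _ hpos (hch p hp)) as hrp.
      destruct (splits_open ls (dd p) hrp h1) as [d [hd ho]].
      apply NNPP; intros hn; apply h2, half_chain_closed; auto.
      intros e he; apply NNPP; intros hm; apply hn.
      assert (hmin : 0 < Rmin (d / 2) e) by (apply Rmin_glb_lt; lra).
      pose proof (Rmin_l (d / 2) e); pose proof (Rmin_r (d / 2) e).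
      exists (Rmin (d / 2) e); split; [easy |].
      intros q hq hpq; apply near_extend in hpq.
      split.
      + apply ho; [apply chain_range with (2 := hch q hq); auto |].
        unfold dd; eapply Rle_lt_trans; [apply pdist_lipschitz |].
        pose proof (hpq u hu); pose proof (hpq v hv); lra.
      + intros hh; apply hm.
        exists (extend V P q u), (extend V P q v), (map (extend V P q) (inner P ++ [v])).
        pose proof (hpq u hu); pose proof (hpq v hv).
        split; [lra | split; [lra | split; [| easy]]].
        apply near_list_map; intros w hw; pose proof (hpq w (hin w hw)); lra. }
  assert (ne : forall t, exists p, fiber P u v x p /\ H t p).
  { intros t; destruct (path_realize t x hr) as [f [h1 [h2 h3]]].
    exists (restrict V P f); split; [split |].
    - now apply inC_restrict.
    - apply dist_at_extend; rewrite !extend_restrict; auto.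
    - unfold H; rewrite !extend_restrict by easy.
      erewrite map_ext_in; [exact h3 |]; intros w hw; apply extend_restrict; auto. }
  assert (hdd : forall p, fiber P u v x p -> splits ls (dd p)).
  { intros p [_ hp]; apply dist_at_extend in hp; destruct hp as [_ [_ hp]].
    unfold dd; now rewrite hp. }
  assert (sep : forall p, fiber P u v x p -> H true p -> H false p -> False).
  { intros p hp; apply half_chain_sep; auto; now apply hdd. }
  apply hc.
  exists (fun p => splits ls (dd p) /\ ~ H true p), (fun p => splits ls (dd p) /\ ~ H false p).
  split; [apply op | split; [apply op | split; [| split; [| split]]]].
  - intros p hp; pose proof (hdd p hp); destruct (classic (H true p)) as [ht | ht].
    + right; split; [easy |]; intros hf; now apply (sep p).
    + now left.
  - intros p hp [_ h1] [_ h2]; destruct hp as [hp _].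
    destruct (chain_cover _ _ _ _ hpos (hch p hp)); auto.
  - destruct (ne false) as [p [hp hf]]; exists p; split; [easy |].
    split; [now apply hdd |]; intros ht; now apply (sep p).
  - destruct (ne true) as [p [hp ht]]; exists p; split; [easy |].
    split; [now apply hdd |]; intros hf; now apply (sep p).
Qed.

End Path.

(** * Parallel paths over a common base *)

(** The terminals are listed separately because [EK] may be empty. *)
Definition base_verts {V} (u v : V) (EK : list (edge V)) (w : V) : Prop :=
  w = u \/ w = v \/ verts EK w.

Definition base_sat {V} (u v : V) (a b : R) (EK : list (edge V)) (f : V -> R2) : Prop :=
  sat EK f /\ a <= pdist (f u) (f v) <= b.

Lemma sat_Ledges {V} n P (EK : list (edge V)) f :
  sat (Ledges n P EK) f <-> (forall i, (i < n)%nat -> sat (P i) f) /\ sat EK f.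
Proof.
  unfold Ledges; rewrite sat_app; split; intros [h h']; split; auto.
  - intros i hi x y l he; apply h, in_concat; exists (P i); split; [| easy].
    apply in_map, in_seq; lia.
  - intros x y l he; apply in_concat in he; destruct he as [E [hE he]].
    apply in_map_iff in hE; destruct hE as [i [<- hi]]; apply in_seq in hi.
    apply (h i); [lia | easy].
Qed.

Lemma verts_Ledges {V} n P (EK : list (edge V)) w :
  verts (Ledges n P EK) w <-> (exists i, (i < n)%nat /\ verts (P i) w) \/ verts EK w.
Proof.
  unfold verts, Ledges; rewrite vertsOf_app, in_app_iff.
  assert (h : In w (vertsOf (concat (map P (seq 0 n)))) <->
     exists i, (i < n)%nat /\ In w (vertsOf (P i))); [| now rewrite h].
  unfold vertsOf; split.
  - intros h; apply in_flat_map in h; destruct h as [e [he hw]].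
    apply in_concat in he; destruct he as [E [hE he]].
    apply in_map_iff in hE; destruct hE as [i [<- hi]]; apply in_seq in hi.
    exists i; split; [lia |]; apply in_flat_map; eauto.
  - intros [i [hi h]]; apply in_flat_map in h; destruct h as [e [he hw]].
    apply in_flat_map; exists e; split; [| easy].
    apply in_concat; exists (P i); split; [apply in_map, in_seq; lia | easy].
Qed.

(** The bounds [a] and [b] are imposed on the base from the start, so every intermediate linkage
    keeps its terminals within the range of every path still to be added. *)
Lemma paths_connected {V} (u v : V) n (P : nat -> list (edge V)) EK a b :
  (1 <= n)%nat ->
  (forall i, (i < n)%nat -> is_path_graph (P i) u v) ->
  (forall i, (i < n)%nat -> all_nonneg (map snd (P i))) ->
  (forall i j, (i < n)%nat -> (j < n)%nat -> i <> j ->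
     forall w, verts (P i) w -> verts (P j) w -> w = u \/ w = v) ->
  (forall i, (i < n)%nat -> forall w, verts (P i) w -> verts EK w -> w = u \/ w = v) ->
  (forall x, (forall i, (i < n)%nat ->
     chain_min (map snd (P i)) <= x <= chain_max (map snd (P i))) <-> a <= x <= b) ->
  (forall i, (i < n)%nat -> exists k, base_sat u v a b EK k /\
     ~ splits (map snd (P i)) (pdist (k u) (k v))) ->
  M_connected (Ledges n P EK) <->
  connected_mod (base_verts u v EK) (base_sat u v a b EK).
Proof.
  intros hn hP hpos hdisj hKdisj hrange hwit.
  set (N j w := base_verts u v EK w \/ exists i, (i < j)%nat /\ In w (inner (P i))).
  set (S j f := base_sat u v a b EK f /\ forall i, (i < j)%nat -> sat (P i) f).
  (* The lifting clause carries the non-splitting witness for the next path from the base up to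
     [S j], with the same distance between terminals. *)
  assert (step : forall j, (j <= n)%nat -> invariant (N j) (S j) /\
    (connected_mod (base_verts u v EK) (base_sat u v a b EK) <->
       connected_mod (N j) (S j)) /\
    forall k, base_sat u v a b EK k ->
      exists f, S j f /\ forall w, base_verts u v EK w -> f w = k w).
  { induction j as [| j IH].
    - intros _; assert (hN0 : forall w, base_verts u v EK w <-> N 0%nat w).
      { intros w; split; [now left |]; intros [h | [i [hi _]]]; [easy | lia]. }
      assert (hS0 : forall f, base_sat u v a b EK f <-> S 0%nat f).
      { intros f; split; [intros h; split; [easy | intros; lia] | now intros [h _]]. }
      split; [| split].
      + intros f g hf [c [s [tx [ty [e h]]]]]; apply hS0; apply hS0 in hf.
        destruct hf as [h1 h2]; split.
        * apply (sat_invariant EK (N 0%nat)) with (f := f); auto.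
          -- intros w hw; left; right; now right.
          -- exists c, s, tx, ty; auto.
        * rewrite !h, pdist_rigid; auto; left; [right; left | left]; easy.
      + now apply connected_mod_ext.
      + intros k hk; exists k; split; [now apply hS0 | easy].
    - intros hj; destruct IH as [inv [conn lft]]; [lia |].
      assert (hPj := hP j hj); destruct (path_inner _ _ _ hPj) as [nd _].
      inversion nd as [| ? ? n1 n2]; inversion n2 as [| ? ? n3 n4]; subst.
      assert (hu : N j u) by (left; left; easy).
      assert (hv : N j v) by (left; right; left; easy).
      assert (fresh : forall w, In w (inner (P j)) -> ~ N j w).
      { intros w hw hN.
        assert (hw' : verts (P j) w) by (apply (path_verts _ u v); auto).
        assert (w = u \/ w = v) as [-> | ->]; [| apply n1; now right | now apply n3].
        destruct hN as [[h | [h | h]] | [i [hi h]]]; auto.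
        - now apply (hKdisj j).
        - apply (hdisj i j); auto; try lia; apply (path_verts _ u v); auto; apply hP; lia. }
      assert (rg : forall f, S j f -> chain_min (map snd (P j)) <= pdist (f u) (f v)
                                       <= chain_max (map snd (P j))).
      { intros f [[_ h] _]; now apply hrange. }
      assert (hN' : forall w, N j w \/ In w (inner (P j)) <-> N (Datatypes.S j) w).
      { intros w; split.
        - intros [[h | [i [hi h]]] | h]; [now left | |]; right;
            [exists i | exists j]; split; auto; lia.
        - intros [h | [i [hi h]]]; [now left; left |].
          destruct (Nat.eq_dec i j) as [-> | ne]; [now right |].
          left; right; exists i; split; [lia | easy]. }
      assert (hS' : forall f, S j f /\ chain (map snd (P j)) (f u) (f v)
           (map f (inner (P j) ++ [v])) <-> S (Datatypes.S j) f).
      { intros f; rewrite <- (sat_path (P j) u v f hPj); split.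
        - intros [[h1 h2] h3]; split; [easy |]; intros i hi.
          destruct (Nat.eq_dec i j) as [-> | ne]; [easy | apply h2; lia].
        - intros [h1 h2]; repeat split; try apply h1; auto. }
      pose proof (path_length (P j) u v hPj) as hlen.
      split; [| split].
      + intros f g hf hfg; apply hS'; apply hS' in hf; revert f g hf hfg.
        assert (iv := add_path_invariant V (N j) (S j) u v (inner (P j)) (map snd (P j))
          hu hv inv).
        intros f g hf [c [s [tx [ty [e h]]]]]; apply (iv f g hf).
        exists c, s, tx, ty; split; [easy |]; intros w hw; now apply h, hN'.
      + rewrite conn, <- (connected_mod_ext _ _ _ _ hN' hS'); split.
        * apply add_path_connected; auto.
          destruct (hwit j hj) as [k [hk hs]]; destruct (lft k hk) as [f [hf ef]].
          exists f; split; [easy |]; rewrite !ef; auto; [right; left | left]; easy.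
        * apply remove_path_connected; auto.
      + intros k hk; destruct (lft k hk) as [f [hf ef]].
        destruct (add_path_lift V (N j) (S j) u v (inner (P j)) (map snd (P j))
          hu hv n4 fresh hlen (hpos j hj) inv rg f hf) as [g [hg eg]].
        exists g; split; [now apply hS' |].
        intros w hw; rewrite eg; [now apply ef | now left]. }
  destruct (step n (le_n n)) as [_ [-> _]].
  rewrite M_connected_total; apply connected_mod_ext.
  - intros w; rewrite verts_Ledges; split.
    + intros [[i [hi h]] | h]; [| left; right; now right].
      apply (path_verts _ u v) in h; [| auto]; destruct h as [h | [h | h]].
      * left; now left.
      * left; right; now left.
      * right; eauto.
    + intros [[-> | [-> | h]] | [i [hi h]]].
      * left; exists 0%nat; split; [lia |]; apply (path_ends V (P 0%nat) u v), hP; lia.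
      * left; exists 0%nat; split; [lia |]; apply (path_ends V (P 0%nat) u v), hP; lia.
      * now right.
      * left; exists i; split; [easy |]; apply (path_verts _ u v); auto.
  - intros f; rewrite sat_Ledges; split.
    + intros [h1 h2]; repeat split; auto; apply hrange; intros i hi;
        apply chain_range with (2 := proj1 (sat_path (P i) u v f (hP i hi)) (h1 i hi)); auto.
    + intros [[h1 _] h2]; auto.
Qed.

(** Composition with [j] and composition with [r] are mutually inverse up to values off the vertex
    sets, which the saturated predicates do not see. *)
Lemma connected_mod_transport {V W} (j : V -> W) (r : W -> V) (N : V -> Prop)
  (N' : W -> Prop) S S' :
  (forall x, r (j x) = x) -> (forall w, N' w <-> exists x, w = j x /\ N x) ->
  invariant N S -> (forall f, S' f <-> S (fun x => f (j x))) ->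
  connected_mod N S <-> connected_mod N' S'.
Proof.
  intros hr hN inv hS.
  assert (inj : forall x, N x -> N' (j x)) by (intros; apply hN; eauto).
  assert (back : forall g, S g -> S' (fun w => g (r w))).
  { intros g hg; apply hS, (inv g); [easy |]; apply congruent_on_eq.
    intros; now rewrite hr. }
  split; intros hc U sat loc f g hf hg hU.
  - assert (tr : forall f, S' f -> (U (fun w => f (j (r w))) <-> U f)).
    { intros f0 h0; pose proof (back _ (proj1 (hS f0) h0)) as h1.
      split; apply sat; auto; apply congruent_on_eq; intros w hw;
        apply hN in hw; destruct hw as [x [-> _]]; now rewrite hr. }
    apply tr; [easy |].
    refine (hc (fun g => U (fun w => g (r w))) _ _ (fun x => f (j x))
      (fun x => g (j x)) (proj1 (hS f) hf) (proj1 (hS g) hg) (proj2 (tr f hf) hU)).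
    + intros f0 g0 h1 h2 [c [s [tx [ty [e h]]]]]; apply sat; auto.
      exists c, s, tx, ty; split; [easy |]; intros w hw.
      apply hN in hw; destruct hw as [x [-> hx]]; rewrite hr; auto.
    + intros f0 h1; destruct (loc _ (back f0 h1)) as [e [he h]].
      exists e; split; [easy |]; intros g0 h2 hn; apply h; auto.
      intros w hw; apply hN in hw; destruct hw as [x [-> hx]]; rewrite hr; auto.
  - assert (agree : forall g x, g (r (j x)) = g x :> R2) by (intros; now rewrite hr).
    assert (tr : forall g, S g -> (U (fun x => g (r (j x))) <-> U g)).
    { intros g0 h0; assert (S (fun x => g0 (r (j x)))).
      { apply (inv g0); [easy |]; apply congruent_on_eq; intros; now rewrite agree. }
      split; apply sat; auto; apply congruent_on_eq; intros; now rewrite agree. }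
    apply tr; [easy |].
    refine (hc (fun f => U (fun x => f (j x))) _ _ (fun w => f (r w))
      (fun w => g (r w)) (back f hf) (back g hg) (proj2 (tr f hf) hU)).
    + intros f0 g0 h1 h2 [c [s [tx [ty [e h]]]]]; apply sat; try now apply hS.
      exists c, s, tx, ty; auto.
    + intros f0 h1; destruct (loc _ (proj1 (hS f0) h1)) as [e [he h]].
      exists e; split; [easy |]; intros g0 h2 hn; apply h; [now apply hS |].
      intros x hx; apply (hn (j x)); auto.
Qed.

(** The initial value [a 0] of the fold is itself one of the values, since [1 <= n]. *)
Lemma amax_le n a x : (1 <= n)%nat ->
  (amax n a <= x <-> forall i, (i < n)%nat -> a i <= x).
Proof.
  intros hn; unfold amax.
  assert (h : forall s, fold_right (fun i acc => Rmax (a i) acc) (a 0%nat) s <= x <->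
    a 0%nat <= x /\ forall i, In i s -> a i <= x).
  { induction s as [| k s IH]; simpl; [tauto |].
    split.
    - intros h; assert (h1 := Rle_trans _ _ _ (Rmax_l _ _) h).
      assert (h2 := Rle_trans _ _ _ (Rmax_r _ _) h); apply IH in h2.
      split; [tauto |]; intros i [<- | hi]; [easy | now apply h2].
    - intros [h1 h2]; apply Rmax_lub; auto; apply IH; auto. }
  rewrite h; split.
  - intros [_ h2] i hi; apply h2, in_seq; lia.
  - intros h2; split; [apply h2; lia |]; intros i hi; apply in_seq in hi; apply h2; lia.
Qed.

Lemma le_bmin n b x : (1 <= n)%nat ->
  (x <= bmin n b <-> forall i, (i < n)%nat -> x <= b i).
Proof.
  intros hn; unfold bmin.
  assert (h : forall s, x <= fold_right (fun i acc => Rmin (b i) acc) (b 0%nat) s <->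
    x <= b 0%nat /\ forall i, In i s -> x <= b i).
  { induction s as [| k s IH]; simpl; [tauto |].
    split.
    - intros h; assert (h1 := Rle_trans _ _ _ h (Rmin_l _ _)).
      assert (h2 := Rle_trans _ _ _ h (Rmin_r _ _)); apply IH in h2.
      split; [tauto |]; intros i [<- | hi]; [easy | now apply h2].
    - intros [h1 h2]; apply Rmin_glb; auto; apply IH; auto. }
  rewrite h; split.
  - intros [_ h2] i hi; apply h2, in_seq; lia.
  - intros h2; split; [apply h2; lia |]; intros i hi; apply in_seq in hi; apply h2; lia.
Qed.

(** * The replacement path *)

Section Replacement.
Variables m d : R.
Hypothesis hd : 0 <= d.
Hypothesis hm : 3 * d <= m.

Lemma chain_min_3 : chain_min [d; d; d] = 0.
Proof.
  assert (e1 : chain_min [d] = d) by (simpl; case_max; lra).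
  assert (e2 : chain_min [d; d] = 0).
  { transitivity (Rmax 0 (Rmax (d - (d + 0)) (chain_min [d] - d))); [easy |].
    rewrite e1; case_max; lra. }
  transitivity (Rmax 0 (Rmax (d - (d + (d + 0))) (chain_min [d; d] - d))); [easy |].
  rewrite e2; case_max; lra.
Qed.

Lemma replacement_range :
  chain_min [m; d; d; d] = m - 3 * d /\ chain_max [m; d; d; d] = m + 3 * d.
Proof.
  split; [| simpl; ring].
  transitivity (Rmax 0 (Rmax (m - (d + (d + (d + 0)))) (chain_min [d; d; d] - m)));
    [easy |].
  rewrite chain_min_3; case_max; lra.
Qed.

(** The three short edges can close up into an equilateral triangle, so their least distance is 0
    and [turns] fails; they can also be straight at distance [3 * d], which is admissible for every
    [x] in the range and does not split. *)
Lemma replacement_not_splits x : m - 3 * d <= x <= m + 3 * d ->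
  ~ splits [m; d; d; d] x.
Proof.
  intros hx.
  assert (hn : all_nonneg [d; d; d]) by (repeat (apply Forall_cons; [easy |]); constructor).
  assert (e : chain_max [d; d; d] = 3 * d) by (simpl; ring).
  intros [[h _] | h].
  - rewrite chain_min_3 in h; pose proof (Rabs_pos (x - m)); lra.
  - apply (splits_max _ hn), h; rewrite e; [rewrite chain_min_3; lra | case_abs; lra].
Qed.

End Replacement.

Theorem mainTheorem14 (V : Type) (u v : V) (n : nat)
  (P : nat -> list (edge V)) (EK : list (edge V)) (ai bi : nat -> R)
  (Huv : u <> v) (Hn : (2 <= n)%nat)
  (HP : forall i, (i < n)%nat -> is_path_graph (P i) u v)
  (Hpos : forall i, (i < n)%nat -> forall e, In e (P i) -> 0 < snd e)
  (Hdisj : forall i j, (i < n)%nat -> (j < n)%nat -> i <> j ->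
     forall w, In w (vertsOf (P i)) -> In w (vertsOf (P j)) -> w = u \/ w = v)
  (HK : EK = [] \/ ttsp EK u v)
  (HKlen : forall e, In e EK -> 0 <= snd e)
  (HKdisj : forall i, (i < n)%nat ->
     forall w, In w (vertsOf (P i)) -> In w (vertsOf EK) -> w = u \/ w = v)
  (Hint : forall i, (i < n)%nat ->
     forall x, distRange (P i) u v x <-> ai i <= x <= bi i)
  (HM : M_nonempty (Ledges n P EK))
  (Hnab : forall i, (i < n)%nat ->
     exists x, nabla (P i) u v x /\ distRange (Ledges n P EK) u v x) :
  M_connected (Ledges n P EK) <->
  M_connected (L1_edges u v (amax n ai) (bmin n bi) EK).
Proof.
  set (a := amax n ai); set (b := bmin n bi).
  assert (hpos : forall i, (i < n)%nat -> all_nonneg (map snd (P i))).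
  { intros i hi; apply Forall_forall; intros l hl; apply in_map_iff in hl.
    destruct hl as [e [<- he]]; left; now apply (Hpos i). }
  assert (hends : forall i, (i < n)%nat -> forall x,
    chain_min (map snd (P i)) <= x <= chain_max (map snd (P i)) <-> ai i <= x <= bi i).
  { intros i hi x; rewrite <- Hint, (path_distRange V (P i) u v) by auto; easy. }
  assert (hab : forall x, (forall i, (i < n)%nat -> ai i <= x <= bi i) <-> a <= x <= b).
  { intros x; unfold a, b; rewrite amax_le, le_bmin by lia; split.
    - intros h; split; intros i hi; now apply h.
    - intros [h1 h2] i hi; auto. }
  assert (hbase : forall f, sat (Ledges n P EK) f -> base_sat u v a b EK f).
  { intros f hf; apply sat_Ledges in hf; destruct hf as [h1 h2].
    split; [easy |]; apply hab; intros i hi; apply hends; auto.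
    apply chain_range with (2 := proj1 (sat_path (P i) u v f (HP i hi)) (h1 i hi)); auto. }
  destruct HM as [p hp]; apply inC_extend, hbase in hp; set (k := extend _ _ p) in hp.
  destruct hp as [hk hkab].
  (* With [m = (a + b) / 2] and [d = (b - a) / 6], the range from [m - 3 * d] to [m + 3 * d] is the
     interval from [a] to [b], and the condition [3 * d <= m] amounts to [0 <= a]. *)
  assert (ha : 0 <= a).
  { assert (hx : forall i, (i < n)%nat -> ai i <= pdist (k u) (k v) <= bi i) by now apply hab.
    apply Rle_trans with (ai 0%nat).
    - pose proof (chain_min_le_max _ (hpos 0%nat ltac:(lia))) as hc.
      assert (ai 0%nat <= bi 0%nat) by (specialize (hx 0%nat ltac:(lia)); lra).
      assert (h := proj2 (hends 0%nat ltac:(lia) (ai 0%nat)) ltac:(lra)); lra.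
    - apply (amax_le n ai a); [lia | apply Rle_refl | lia]. }
  rewrite (paths_connected u v n P EK a b); auto; try lia.
  2:{ intros x; rewrite <- hab; split; intros h i hi; apply hends; auto. }
  (* A configuration of the full linkage realizing a distance in [nabla] satisfies the base
     constraints and is the required witness. *)
  2:{ intros i hi; destruct (Hnab i hi) as [x [h1 [q [h2 h3]]]].
      exists (extend _ _ q); split; [now apply hbase, inC_extend |].
      apply dist_at_extend in h3; destruct h3 as [_ [_ ->]].
      apply (nabla_not_splits V (P i) u v); auto. }
  set (Q := [(lift u, None, (a + b) / 2); (None, Some None, (b - a) / 6);
             (Some None, Some (Some None), (b - a) / 6);
             (Some (Some None), lift v, (b - a) / 6)]).
  assert (hQ : is_path_graph Q (lift u) (lift v)).
  { exists [None; Some None; Some (Some None)]; split; [| easy].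
    repeat constructor; simpl; intros h; repeat destruct h as [h | h]; try easy.
    injection h; auto. }
  assert (hd : 0 <= (b - a) / 6) by lra.
  assert (hm : 3 * ((b - a) / 6) <= (a + b) / 2) by lra.
  destruct (replacement_range _ _ hd hm) as [e1 e2].
  assert (hlift : forall w, verts (map liftE EK) w <-> exists x, w = lift x /\ verts EK x).
  { intros w; unfold verts, vertsOf; rewrite in_flat_map; split.
    - intros [e [he hw]]; apply in_map_iff in he; destruct he as [[[x y] l] [<- he]].
      destruct (edge_verts EK x y l he).
      simpl in hw; destruct hw as [<- | [<- | []]]; eauto.
    - intros [x [-> hx]]; apply in_flat_map in hx; destruct hx as [e [he hx]].
      exists (liftE e); split; [now apply in_map |].
      destruct hx as [<- | [<- | []]]; simpl; auto. }
  change (L1_edges u v a b EK) with (Ledges 1 (fun _ => Q) (map liftE EK)).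
  rewrite (paths_connected (lift u) (lift v) 1 (fun _ => Q) (map liftE EK) a b); auto.
  (* The base contains none of the fresh vertices of [Q], so the retraction may send them to [u]. *)
  - apply (connected_mod_transport lift (fun w => match w with
      | Some (Some (Some x)) => x | _ => u end)).
    + easy.
    + intros w; unfold base_verts; rewrite hlift; split.
      * intros [-> | [-> | [x [-> hx]]]]; eauto.
      * intros [x [-> [-> | [-> | hx]]]]; eauto.
    + intros f g [h1 h2] hfg; split.
      * apply (sat_invariant EK (base_verts u v EK)) with (f := f); auto.
        intros w hw; right; now right.
      * destruct hfg as [c [s [tx [ty [e h]]]]].
        rewrite !h, pdist_rigid; auto; [right; left | left]; easy.
    + intros f; unfold base_sat.
      assert (h : sat (map liftE EK) f <-> sat EK (fun x => f (lift x))); [| now rewrite h].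
      split.
      * intros h x y l hi; apply h; now apply (in_map liftE) in hi.
      * intros h x y l hi; apply in_map_iff in hi; destruct hi as [[[x' y'] l'] [e hi]].
        injection e; intros <- <- <-; now apply h.
  - intros _ _; simpl map; repeat (apply Forall_cons; [lra |]); constructor.
  - intros; lia.
  - intros _ _ w hw hw'; apply hlift in hw'; destruct hw' as [x [-> _]].
    apply (path_verts Q (lift u) (lift v)) in hw; auto.
    destruct hw as [hw | [hw | hw]]; auto.
    simpl in hw; repeat destruct hw as [hw | hw]; easy.
  - intros x; simpl map; rewrite e1, e2; split.
    + intros h; specialize (h 0%nat ltac:(lia)); lra.
    + intros h _ _; lra.
  (* Since [Q] never splits on its range, any configuration of the base will do; [k] comes from the
     nonemptiness of [M(L)]. *)
  - intros _ _; exists (fun w => match w with Some (Some (Some x)) => k x | _ => (0, 0) end).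
    split; [split; [| easy] |].
    + intros x y l hi; apply in_map_iff in hi; destruct hi as [[[x' y'] l'] [e hi]].
      injection e; intros <- <- <-; now apply hk.
    + simpl map; apply replacement_not_splits; simpl; lra.
Qed.
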